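(* Let $\mathcal X$ be a Polish space with Borel $\sigma$-algebra and $\sigma$-finite reference measure $\mathrm dx$; let $\pi,\pi_Y$ be probability measures with densities (also denoted $\pi,\pi_Y$) and $w=\pi/\pi_Y$ with $|w|_\infty<\infty$. Fix $\epsilon\in(0,1)$ and a Markov kernel $P$ on $\mathcal X$ with stationary distribution $\pi$. Let $\{(X_n,Y_n)\}_{n\ge0}$ be generated by the Importance Resampling MCMC algorithm: $X_0=x_0$, $Y_0=y_0$; with $\mathcal F_n=\sigma(X_0,\dots,X_n,Y_0,\dots,Y_n)$, the auxiliary process satisfies $\mathbb E(h(Y_{n+1})\mid\mathcal F_n)=\mathbb E(h(Y_{n+1})\mid Y_0,\dots,Y_n)$ for bounded measurable $h$ (otherwise its dynamics are arbitrary); given $\mathcal F_{n-1}$, $X_n$ and $Y_n$ are conditionally independent, and $X_n$ is drawn from $P(X_{n-1},\cdot)$ with probability $1-\epsilon$ and from $\hat\theta_{n-1}$ with probability $\epsilon$, where the choice is made by i.i.d. Bernoulli($\epsilon$) variables $Z_n$ independent of $\{Y_k\}$ and of $\mathcal F_{n-1}$, and \[ \hat\theta_n=\sum_{i=1}^n\frac{w(Y_i)}{\sum_{j=1}^nw(Y_j)}\delta_{Y_i}\ (n\ge1),\qquad \hat\theta_0=\delta_{y_0}. \] Define for $n\ge1$ \[ B_n=|w|_\infty\sup_{|f|\le1}\mathbb E\,\hat\pi_{Y,n}(\bar f)+2|w|_\infty^2\sup_{|f|\le1}\mathbb E\big(\hat\pi_{Y,n}(\bar f)\big)^2, \] and $B_0=B_{-1}=1$.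 Then for all $n$, \[ \|\mathcal L_{X_n}-\pi\|_{TV}\le\sum_{\ell=0}^n(1-\epsilon)^{n-\ell}B_{\ell-1}, \] and for every bounded measurable $f$ and $n\in\mathbb N$, \[ \mathbb E\Big[\frac1{\sqrt n}\sum_{i=1}^n(f(X_i)-\pi(f))\Big]^2\le\frac{80\epsilon^{-2}|f|_\infty^2}{n}+64\epsilon^{-2}|f|_\infty^2+|f|_\infty^2\Big(\frac1{\sqrt n}\sum_{k=0}^{n-1}\sqrt{B_k}\Big)^2 . \]
   Context: $\hat\pi_{Y,n}=\frac1n\sum_{i=1}^n\delta_{Y_i}$ and $\hat\pi_{Y,n}(\bar f)=\hat\pi_{Y,n}(f)-\pi_Y(f)$; suprema are over measurable $f$ with $|f|\le1$. $\mathcal L_{X_n}$ denotes the law of $X_n$ and $\|\mu-\nu\|_{TV}=\frac12\sup_{|f|\le1}|\mu(f)-\nu(f)|$. $|f|_\infty=\sup_x|f(x)|$. *)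

(* Defs.v *)
From HB Require Import structures.
From mathcomp Require Import all_boot all_order all_algebra.
From mathcomp Require Import all_classical all_reals all_analysis.

Set Implicit Arguments.
Unset Strict Implicit.
Unset Printing Implicit Defensive.
Import Order.TTheory GRing.Theory Num.Theory.
Import numFieldNormedType.Exports.
Local Open Scope classical_set_scope.
Local Open Scope ring_scope.

Section Defs.
Context {R : realType}.

Definition is_metric {T : Type} (dist : T -> T -> R) : Prop :=
  (forall x y, 0 <= dist x y) /\ (forall x y, dist x y = 0 <-> x = y) /\
  (forall x y, dist x y = dist y x) /\
  (forall x y z, dist x z <= dist x y + dist y z).

Definition metric_open {T : Type} (dist : T -> T -> R) (A : set T) : Prop :=
  forall x, A x -> exists r : R, 0 < r /\ [set y | dist x y < r] `<=` A.

Definition polish_borel {d} (T : measurableType d) : Prop :=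
  exists dist : T -> T -> R,
    is_metric dist /\
    (forall u : nat -> T,
        (forall e : R, 0 < e -> exists N, forall m n, (N <= m)%N -> (N <= n)%N ->
           dist (u m) (u n) < e) ->
        exists l, forall e : R, 0 < e -> exists N, forall n, (N <= n)%N ->
           dist (u n) l < e) /\
    (exists D : nat -> T, forall x (e : R), 0 < e -> exists n, dist x (D n) < e) /\
    (forall A : set T, measurable A <-> <<s metric_open dist >> A).

Definition supnorm {T : Type} (f : T -> R) : R := sup [set `|f x| | x in [set: T]].

Definition integ {d} {T : measurableType d} (mu : set T -> \bar R) (f : T -> R) : R :=
  fine (\int[mu]_x (f x)%:E)%E.

Definition Ex {d} {Om : measurableType d} (Pr : probability Om R) (g : Om -> R) : R :=
  integ Pr g.

Definition preim {dO d} {Om : measurableType dO} {T : measurableType d}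
  (V : Om -> T) : set (set Om) := [set V @^-1` B | B in measurable].

Definition F_XY {dO d} {Om : measurableType dO} {T : measurableType d}
  (X Y : nat -> Om -> T) (n : nat) : set (set Om) :=
  <<s [set A | exists k, (k <= n)%N /\ (preim (X k) A \/ preim (Y k) A)] >>.

Definition F_Y {dO d} {Om : measurableType dO} {T : measurableType d}
  (Y : nat -> Om -> T) (n : nat) : set (set Om) :=
  <<s [set A | exists k, (k <= n)%N /\ preim (Y k) A] >>.

Definition F_XYZ {dO d} {Om : measurableType dO} {T : measurableType d}
  (X Y : nat -> Om -> T) (n : nat) (Z : set Om) : set (set Om) :=
  <<s [set A | (exists k, (k <= n)%N /\ (preim (X k) A \/ preim (Y k) A)) \/ A = Z] >>.

Definition F_allY_XY {dO d} {Om : measurableType dO} {T : measurableType d}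
  (X Y : nat -> Om -> T) (n : nat) : set (set Om) :=
  <<s [set A | (exists k, preim (Y k) A) \/
               (exists k, (k <= n)%N /\ preim (X k) A)] >>.

Definition cond_exp {dO} {Om : measurableType dO} (Pr : probability Om R)
  (G : set (set Om)) (U V : Om -> R) : Prop :=
  (forall B : set R, measurable B -> G (V @^-1` B)) /\
  Pr.-integrable [set: Om] (EFin \o V) /\
  (forall A, G A -> (\int[Pr]_(w in A) (U w)%:E = \int[Pr]_(w in A) (V w)%:E)%E).

Definition indep_event {dO} {Om : measurableType dO} (Pr : probability Om R)
  (E : set Om) (G : set (set Om)) : Prop :=
  forall A, G A -> Pr (E `&` A) = (Pr E * Pr A)%E.

Definition mutually_indep {dO} {Om : measurableType dO} (Pr : probability Om R)
  (Z : nat -> set Om) : Prop :=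
  forall (s : seq nat) (b : nat -> bool), uniq s -> all (fun i => (0 < i)%N) s ->
    Pr (\bigcap_(i in [set i | i \in s]) (if b i then Z i else ~` Z i)) =
    (\prod_(i <- s) Pr (if b i then Z i else ~` Z i))%E.

Definition weight {T : Type} (p pY : T -> R) : T -> R := fun x => p x / pY x.

Definition thetahat {dO d} {Om : measurableType dO} {T : measurableType d}
  (w : T -> R) (y0 : T) (Y : nat -> Om -> T) (n : nat) (f : T -> R) (om : Om) : R :=
  if n == 0%N then f y0 else
  (\sum_(1 <= i < n.+1) w (Y i om) * f (Y i om)) / (\sum_(1 <= j < n.+1) w (Y j om)).

Definition pihatYbar {dO d} {Om : measurableType dO} {T : measurableType d}
  (piY : set T -> \bar R) (Y : nat -> Om -> T) (n : nat) (f : T -> R) (om : Om) : R :=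
  (n%:R)^-1 * (\sum_(1 <= i < n.+1) f (Y i om)) - integ piY f.

Definition unit_ball_fun {d} {T : measurableType d} (f : T -> R) : Prop :=
  measurable_fun [set: T] f /\ forall x, `|f x| <= 1.

Definition IR_Bn {dO d} {Om : measurableType dO} {T : measurableType d}
  (Pr : probability Om R) (piY : set T -> \bar R) (W : R) (Y : nat -> Om -> T) (n : nat) : R :=
  W * sup [set Ex Pr (pihatYbar piY Y n f) | f in unit_ball_fun]
  + 2 * W ^+ 2 * sup [set Ex Pr (fun om => (pihatYbar piY Y n f om) ^+ 2) | f in unit_ball_fun].

Definition IR_B {dO d} {Om : measurableType dO} {T : measurableType d}
  (Pr : probability Om R) (piY : set T -> \bar R) (W : R) (Y : nat -> Om -> T) (k : nat) : R :=
  if k == 0%N then 1 else IR_Bn Pr piY W Y k.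

(* l |-> B_{l-1}, with B_{-1} = 1 *)
Definition IR_Bm1 {dO d} {Om : measurableType dO} {T : measurableType d}
  (Pr : probability Om R) (piY : set T -> \bar R) (W : R) (Y : nat -> Om -> T) (l : nat) : R :=
  if l == 0%N then 1 else IR_B Pr piY W Y l.-1.

Definition tv_law {dO d} {Om : measurableType dO} {T : measurableType d}
  (Pr : probability Om R) (V : Om -> T) (nu : set T -> \bar R) : R :=
  2^-1 * sup [set `|Ex Pr (f \o V) - integ nu f| | f in unit_ball_fun].

End Defs.

(* Main.v *)
Require Import Defs.
From HB Require Import structures.
From mathcomp Require Import all_boot all_order all_algebra.
From mathcomp Require Import all_classical all_reals all_analysis.
From mathcomp Require Import measurable_realfun ring lra.
Import Order.TTheory GRing.Theory Num.Theory.
Import numFieldNormedType.Exports.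
Local Open Scope classical_set_scope.
Local Open Scope ring_scope.

(** Write [theta_n] for the importance-sampling estimate of [pi] and [g] for the
    solution of [g - (1 - eps) P g = f]; it solves the Poisson equation of all
    the kernels [(1 - eps) P + eps theta_n] at once.  Given the past,
    [g (X_{n+1})] has mean [(1 - eps) P g (X_n) + eps theta_n g], so
    [\sum_i (f (X_i) - pi f)] is a martingale with increments of size
    [|f| / eps], plus boundary terms, plus the errors [eps (theta_k g - pi g)].
    The same one-step formula gives a recursion of ratio [1 - eps] for the bias
    of the law of [X_n].

    With [a = pihat (w h)], [b = pihat w] (centered empirical means) and
    [t = theta_n h], one has [theta_n h - pi h = a - t b], even when all weights
    vanish.  Since [pihat] kills constants, [E (pihat f)^2] is controlled by the
    oscillation of [f] rather than by its norm; this bounds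
    [E (theta_n h - pi h)^2] by [15/16 |h|^2 B_n], and the gain of [15/16] pays
    for the cross terms, so that the last term of the bound has constant 1. *)

(** * Bounded measurable functions and extension from indicators *)

Section BoundedMeasurable.
Context {R : realType}.

(** Such functions are integrable for every probability measure, so the [fine] in [integ] never
    hides an infinite value. *)
Definition bmeas {d} {T : measurableType d} (f : T -> R) : Prop :=
  measurable_fun [set: T] f /\ exists M, forall x, `|f x| <= M.

Lemma bounded_funP {T : Type} (f : T -> R) :
  bounded_fun f <-> exists M, forall x, `|f x| <= M.
Proof.
split=> [[M [_ Mf]]|[M Mf]].
  by exists (M + 1) => x; apply: Mf => //; rewrite ltrDl ltr01.
exists M; split; first exact: num_real.
by move=> N MN x _; exact: le_trans (Mf x) (ltW MN).
Qed.

Context {d : measure_display} {T : measurableType d}.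
Implicit Types f g : T -> R.

Lemma bmeasP f : measurable_fun [set: T] f -> bounded_fun f -> bmeas f.
Proof. by move=> mf /bounded_funP bf. Qed.

Lemma bmeas_cst (r : R) : bmeas (fun _ : T => r).
Proof. by split; [exact: measurable_cst | exists `|r| => x]. Qed.

Lemma bmeasD f g : bmeas f -> bmeas g -> bmeas (fun x => f x + g x).
Proof.
move=> [mf [M fM]] [mg [N gN]]; split; first exact: measurable_funD.
by exists (M + N) => x; apply: le_trans (ler_normD _ _) _; exact: lerD.
Qed.

Lemma bmeasM f g : bmeas f -> bmeas g -> bmeas (fun x => f x * g x).
Proof.
move=> [mf [M fM]] [mg [N gN]]; split; first exact: measurable_funM.
by exists (M * N) => x; rewrite normrM; apply: ler_pM.
Qed.

Lemma bmeasN f : bmeas f -> bmeas (fun x => - f x).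
Proof.
move=> bf; rewrite (_ : (fun x => _) = (fun x => -1 * f x)).
  by apply: bmeasM => //; exact: bmeas_cst.
by apply/funext => x; rewrite mulN1r.
Qed.

Lemma bmeasB f g : bmeas f -> bmeas g -> bmeas (fun x => f x - g x).
Proof. by move=> bf bg; apply: bmeasD => //; exact: bmeasN. Qed.

Lemma bmeasX f n : bmeas f -> bmeas (fun x => f x ^+ n).
Proof.
move=> bf; elim: n => [|n IHn]; first exact: bmeas_cst.
rewrite (_ : (fun x => _) = (fun x => f x * f x ^+ n)); first exact: bmeasM.
by apply/funext => x; rewrite exprS.
Qed.

Lemma bmeas_sum (I : eqType) (s : seq I) (F : I -> T -> R) :
  (forall i, i \in s -> bmeas (F i)) -> bmeas (fun x => \sum_(i <- s) F i x).
Proof.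
elim: s => [|i s IHs] bF.
  rewrite (_ : (fun x => _) = fun=> 0); first exact: bmeas_cst.
  by apply/funext => x; rewrite big_nil.
rewrite (_ : (fun x => _) = fun x => F i x + \sum_(j <- s) F j x).
  apply: bmeasD; first by apply: bF; rewrite mem_head.
  by apply: IHs => j js; apply: bF; rewrite in_cons js orbT.
by apply/funext => x; rewrite big_cons.
Qed.

Lemma bmeas_indic (A : set T) : measurable A -> bmeas (\1_A : T -> R).
Proof.
move=> mA; split; first exact: measurable_indic.
by exists 1 => x; rewrite indicE; case: (_ \in _); rewrite ?normr1 ?normr0.
Qed.

(* Halving: [f - 1_{f >= 1/2} / 2] takes values in [0, 1/2] when [f] takes
   values in [0, 1], so [|L f|] is bounded by [C / 2 ^ n] for every [n]. *)
Lemma bmeas_functional_eq0 (L : (T -> R) -> R) (C : R) :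
  (forall a f g, bmeas f -> bmeas g ->
    L (fun x => a * f x + g x) = a * L f + L g) ->
  (forall f, bmeas f -> (forall x, `|f x| <= 1) -> `|L f| <= C) ->
  (forall A, measurable A -> L \1_A = 0) ->
  forall f, bmeas f -> L f = 0.
Proof.
move=> Llin Lbd L1.
have C0 : 0 <= C.
  apply: le_trans (normr_ge0 _) (Lbd (fun=> 0) (bmeas_cst 0) _) => x.
  by rewrite normr0.
have small n f : bmeas f -> (forall x, 0 <= f x <= 1) ->
    `|L f| <= C / 2 ^+ n.
  elim: n f => [|n IHn] f bf f01.
    rewrite expr0 divr1; apply: Lbd => // x.
    by have /andP[? ?] := f01 x; rewrite ger0_norm.
  pose A := [set x | 2^-1 <= f x].
  have mA : measurable A.
    have -> : A = f @^-1` `[2^-1, +oo[.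
      by apply/seteqP; split=> x /=; rewrite in_itv /= andbT.
    by rewrite -[_ @^-1` _]setTI; apply: bf.1.
  have bA := bmeas_indic A mA.
  (* Twice the halved remainder: it is again [0, 1]-valued, and [L g = 2 * L f] because [L] kills
     indicators. *)
  pose g x := -1 * \1_A x + 2 * f x.
  have bf2 : bmeas (fun x => 2 * f x) by apply: bmeasM => //; exact: bmeas_cst.
  have bg : bmeas g.
    by apply: bmeasD => //; apply: bmeasM => //; exact: bmeas_cst.
  have g01 x : 0 <= g x <= 1.
    have /andP[? ?] := f01 x; rewrite /g indicE.
    have [/set_mem|/negP nA] := boolP (x \in A); rewrite /A /=; first by lra.
    have : f x < 2^-1 by rewrite ltNge; apply/negP => ?; apply: nA; exact/mem_set.
    by rewrite /=; lra.
  have Lg : L g = 2 * L f.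
    rewrite /g (Llin (-1)) // L1 // mulr0 add0r.
    have := Llin 2 f (fun=> 0) bf (bmeas_cst 0).
    have := Llin 1 (fun=> 0) (fun=> 0) (bmeas_cst 0) (bmeas_cst 0).
    rewrite (_ : (fun _ : T => 1 * 0 + 0) = (fun=> 0)); last first.
      by apply/funext => x; rewrite mulr0 addr0.
    rewrite (_ : (fun x : T => 2 * f x + 0) = (fun x => 2 * f x)); last first.
      by apply/funext => x; rewrite addr0.
    by move=> L0 ->; lra.
  have := IHn g bg g01; rewrite Lg normrM (ger0_norm (ler0n _ 2)).
  by rewrite exprSr invfM mulrA; set c := C / _; lra.
have L01 f : bmeas f -> (forall x, 0 <= f x <= 1) -> L f = 0.
  move=> bf f01; apply/eqP/negPn/negP => Lf.
  have Lf0 : 0 < `|L f| by rewrite normr_gt0.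
  have /cvgrPdist_lt /(_ _ Lf0) [n _ /(_ n (leqnn _))] /= :
      (fun n => C / 2 ^+ n : R) @ \oo --> (0 : R).
    under eq_fun do rewrite -exprVn.
    rewrite -(mulr0 C); apply: cvgMr; apply: cvg_expr.
    by rewrite ger0_norm ?invr_ge0 //; lra.
  rewrite sub0r normrN ltNge => /negP; apply.
  by apply: le_trans (small n _ bf f01) (ler_norm _).
move=> f [mf [M fM]].
pose K := `|M| + 1.
have K0 : 0 < K by rewrite ltr_wpDl.
have fK x : `|f x| <= K.
  by apply: le_trans (fM x) _; apply: le_trans (ler_norm _) _; rewrite lerDl.
(* The affine map from [-K, K] to [0, 1]. Undoing it adds a multiple of [\1_setT], which [L] also
   kills. *)
pose g x := (2 * K)^-1 * f x + 2^-1.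
have bf : bmeas f by split=> //; exists M.
have bg : bmeas g.
  by apply: bmeasD; [apply: bmeasM => //|]; exact: bmeas_cst.
have g01 x : 0 <= g x <= 1.
  have /andP[h1 h2] : - 2^-1 <= (2 * K)^-1 * f x <= 2^-1.
    rewrite -ler_norml normrM (@ger0_norm _ (2 * K)^-1); last first.
      by rewrite invr_ge0 mulr_ge0 // ltW.
    rewrite invfM -mulrA -[leRHS]mulr1 ler_pM2l ?invr_gt0 //.
    by rewrite mulrC ler_pdivrMr // mul1r.
  by rewrite /g; lra.
have bK : bmeas (fun x : T => - K * (\1_setT x : R) + 0).
  by apply: bmeasD; [apply: bmeasM; [|apply: bmeas_indic]|]; try exact: bmeas_cst.
have -> : f = fun x => 2 * K * g x + (- K * \1_setT x + 0).
  by apply/funext => x; rewrite /g indicT /=; field; lra.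
rewrite Llin // (L01 g) // mulr0 add0r (Llin (- K) \1_setT (fun=> 0)).
- rewrite L1 // (L01 (fun=> 0) (bmeas_cst 0)) ?mulr0 ?addr0 // => x.
  by rewrite lexx ler01.
- exact: bmeas_indic.
- exact: bmeas_cst.
Qed.

End BoundedMeasurable.

(** * Linearity and monotonicity of the real-valued integral *)

Section Integ.
Context {R : realType} {d : measure_display} {T : measurableType d}.
Implicit Types f g : T -> R.

Lemma bmeas_integrable (m : {measure set T -> \bar R}) f :
  m [set: T] = 1%E -> bmeas f -> m.-integrable [set: T] (EFin \o f).
Proof.
move=> m1 [mf bf]; apply: measurable_bounded_integrable => //.
  by rewrite m1 ltry.
exact/bounded_funP.
Qed.

Context (m : {measure set T -> \bar R}) (m1 : m [set: T] = 1%E).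

Lemma integD f g : bmeas f -> bmeas g ->
  integ m (fun x => f x + g x) = integ m f + integ m g.
Proof. by move=> bf bg; apply: RintegralD => //; exact: bmeas_integrable. Qed.

Lemma integB f g : bmeas f -> bmeas g ->
  integ m (fun x => f x - g x) = integ m f - integ m g.
Proof. by move=> bf bg; apply: RintegralB => //; exact: bmeas_integrable. Qed.

Lemma integZ (r : R) f : bmeas f -> integ m (fun x => r * f x) = r * integ m f.
Proof. by move=> bf; apply: RintegralZl => //; exact: bmeas_integrable. Qed.

Lemma integ_cst (r : R) : integ m (fun=> r) = r.
Proof. by rewrite /integ -/(Rintegral _ _ _) Rintegral_cst // m1 mulr1. Qed.

Lemma le_integ f g : bmeas f -> bmeas g -> (forall x, f x <= g x) ->
  integ m f <= integ m g.
Proof.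
by move=> bf bg fg; apply: le_Rintegral => //; exact: bmeas_integrable.
Qed.

Lemma integ_sum (I : eqType) (s : seq I) (F : I -> T -> R) :
  (forall i, i \in s -> bmeas (F i)) ->
  integ m (fun x => \sum_(i <- s) F i x) = \sum_(i <- s) integ m (F i).
Proof.
elim: s => [|i s IHs] bF.
  by rewrite big_nil -[RHS](integ_cst 0); congr integ; apply/funext => x;
    rewrite big_nil.
have bFs j : j \in s -> bmeas (F j).
  by move=> js; apply: bF; rewrite in_cons js orbT.
rewrite big_cons -IHs // -integD; last exact: bmeas_sum.
  by congr integ; apply/funext => x; rewrite big_cons.
by apply: bF; rewrite mem_head.
Qed.

Lemma integ_ge0 f : (forall x, 0 <= f x) -> 0 <= integ m f.
Proof. by move=> f0; apply: Rintegral_ge0. Qed.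

Lemma integ_normr_le (M : R) f : bmeas f -> (forall x, `|f x| <= M) ->
  `|integ m f| <= M.
Proof.
move=> bf fM; rewrite ler_norml -{1}(integ_cst (- M)) -{2}(integ_cst M).
by apply/andP; split; apply: le_integ => //; try exact: bmeas_cst;
  move=> x; have := fM x; rewrite ler_norml => /andP[].
Qed.

Lemma integ_indic (A : set T) : measurable A -> integ m \1_A = fine (m A).
Proof. by move=> mA; rewrite /integ integral_indic // setIT. Qed.

End Integ.

Arguments integ_cst {R d T m} m1 r.
Arguments integD {R d T m} m1 [f g].
Arguments integB {R d T m} m1 [f g].
Arguments integZ {R d T m} m1 r [f].
Arguments integ_sum {R d T m} m1 [I] s [F].
Arguments le_integ {R d T m} m1 [f g].

(** * Testing against functions measurable for a sub-sigma-algebra *)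

Section SubSigmaAlgebra.
Context {R : realType} {d : measure_display} {Om : measurableType d}.

Lemma bmeas_sub (G1 G2 : set (set Om)) (phi : Om -> R) :
  <<s G1 >> `<=` <<s G2 >> ->
  bmeas (phi : g_sigma_algebraType G1 -> R) ->
  bmeas (phi : g_sigma_algebraType G2 -> R).
Proof. move=> G12 [mphi bphi]; split=> // mT B mB; apply: G12; exact: mphi. Qed.

Lemma bmeas_ambient (G : set (set Om)) (phi : Om -> R) :
  <<s G >> `<=` measurable ->
  bmeas (phi : g_sigma_algebraType G -> R) -> bmeas phi.
Proof. move=> Gm [mphi bphi]; split=> // mT B mB; apply: Gm; exact: mphi. Qed.

Context (Pr : probability Om R).
Let Pr1 : Pr [set: Om] = 1%E := probability_setT Pr.

Lemma Ex_mul_indic (U : Om -> R) (A : set Om) :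
  Ex Pr (fun om => U om * \1_A om) = fine (\int[Pr]_(om in A) (U om)%:E).
Proof.
rewrite /Ex /integ [in RHS]integral_mkcond; congr fine.
apply: eq_integral => om _; rewrite patchE indicE.
by case: (om \in A); rewrite ?mulr1 ?mulr0.
Qed.

(** [bmeas_functional_eq0] is applied on [Om] equipped with the sigma-algebra generated by [G], to
    the functional [f |-> E (D f)], whose bound on the unit ball is a bound of [|D|]. *)
Lemma orthogonal_sub_sigma (G : set (set Om)) (D phi : Om -> R) :
  <<s G >> `<=` measurable -> bmeas D ->
  (forall A, <<s G >> A -> Ex Pr (fun om => D om * \1_A om) = 0) ->
  bmeas (phi : g_sigma_algebraType G -> R) ->
  Ex Pr (fun om => D om * phi om) = 0.
Proof.
move=> Gm bD DA bphi; have [_ [C DC]] := bD.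
pose L (f : g_sigma_algebraType G -> R) := Ex Pr (fun om => D om * f om).
rewrite -[LHS]/(L phi); apply: (bmeas_functional_eq0 L C) => //.
- move=> a f g /(bmeas_ambient _ _ Gm) bf /(bmeas_ambient _ _ Gm) bg.
  rewrite /L /Ex -(integZ Pr1) ?(=^~ integD Pr1); try by do ?apply: bmeasM.
    by congr integ; apply/funext => om; ring.
  by do ?apply: bmeasM => //; exact: bmeas_cst.
- move=> f /(bmeas_ambient _ _ Gm) bf f1; apply: integ_normr_le => //.
    exact: bmeasM.
  by move=> x; rewrite normrM -[C]mulr1; apply: ler_pM => //.
Qed.

(** [cond_exp] tests only on events. Orthogonality of [U - V] to those events extends to bounded
    factors. *)
Lemma cond_exp_mul (G : set (set Om)) (U V phi : Om -> R) :
  <<s G >> `<=` measurable -> bmeas U -> bmeas V ->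
  cond_exp Pr <<s G >> U V -> bmeas (phi : g_sigma_algebraType G -> R) ->
  Ex Pr (fun om => U om * phi om) = Ex Pr (fun om => V om * phi om).
Proof.
move=> Gm bU bV [_ [_ UV]] bphi; have bphi' := bmeas_ambient _ _ Gm bphi.
apply/eqP; rewrite -subr_eq0 /Ex -(integB Pr1); try exact: bmeasM.
rewrite (_ : (fun x => _) = fun x => (U x - V x) * phi x); last first.
  by apply/funext => x; rewrite mulrBl.
apply/eqP/(orthogonal_sub_sigma G) => // [|A GA]; first exact: bmeasB.
have bA : bmeas (\1_A : Om -> R) by apply/bmeas_indic/Gm.
rewrite (_ : (fun x => _) = fun x => U x * \1_A x - V x * \1_A x); last first.
  by apply/funext => x; rewrite mulrBl.
rewrite /Ex (integB Pr1); try exact: bmeasM.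
by rewrite -!/(Ex _ _) !Ex_mul_indic UV // subrr.
Qed.

(** Independence says that the centered indicator [\1_E - Pr E] is orthogonal to all events of the
    sigma-algebra. *)
Lemma indep_event_mul (G : set (set Om)) (E : set Om) (phi : Om -> R) :
  <<s G >> `<=` measurable -> measurable E ->
  indep_event Pr E <<s G >> -> bmeas (phi : g_sigma_algebraType G -> R) ->
  Ex Pr (fun om => \1_E om * phi om) = fine (Pr E) * Ex Pr phi.
Proof.
move=> Gm mE indE bphi; have bphi' := bmeas_ambient _ _ Gm bphi.
have bE : bmeas (\1_E : Om -> R) by exact: bmeas_indic.
have bc (c : R) : bmeas (fun _ : Om => c) by exact: bmeas_cst.
apply/eqP; rewrite -subr_eq0 /Ex -(integZ Pr1) // -(integB Pr1); try exact: bmeasM.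
rewrite (_ : (fun x => _) = fun x => (\1_E x - fine (Pr E)) * phi x); last first.
  by apply/funext => x; rewrite mulrBl.
apply/eqP/(orthogonal_sub_sigma G) => // [|A GA]; first exact: bmeasB.
have mA := Gm _ GA.
have bA : bmeas (\1_A : Om -> R) by exact: bmeas_indic.
have EA : fine (Pr (E `&` A)) = fine (Pr E) * fine (Pr A).
  by rewrite indE // fineM // fin_num_measure.
rewrite (_ : (fun x => _) = fun x => \1_(E `&` A) x - fine (Pr E) * \1_A x).
  rewrite /Ex (integB Pr1) ?(integZ Pr1) //.
  - rewrite !integ_indic //; last exact: measurableI.
    by apply/eqP; rewrite subr_eq0; apply/eqP; exact: EA.
  - by apply: bmeas_indic; exact: measurableI.
  - exact: bmeasM.
by apply/funext => x; rewrite mulrBl indicI.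
Qed.

End SubSigmaAlgebra.

(** * Integration against a density *)

Section Density.
Context {R : realType} {d : measure_display} {T : measurableType d}.
Implicit Types f q : T -> R.

Lemma integ_density (mu nu : {measure set T -> \bar R}) q f :
  nu [set: T] = 1%E -> measurable_fun [set: T] q -> (forall x, 0 <= q x) ->
  (forall A, measurable A -> nu A = \int[mu]_(x in A) (q x)%:E)%E ->
  bmeas f -> integ nu f = integ mu (fun x => f x * q x).
Proof.
move=> nu1 mq q0 nuq bf.
have intq : mu.-integrable [set: T] (EFin \o q).
  apply/integrableP; split; first exact/measurable_EFinP.
  rewrite (_ : (\int[mu]_x `|(EFin \o q) x| = 1)%E) ?ltry // -nu1 nuq //.
  by apply: eq_integral => x _ /=; rewrite ger0_norm.
have intfq g : bmeas g -> mu.-integrable [set: T] (EFin \o (fun x => g x * q x)).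
  move=> [mg [M gM]].
  apply: (@le_integrable _ _ _ mu setT measurableT _
    (EFin \o (fun x => M * q x))) => //.
  - by apply/measurable_EFinP; exact: measurable_funM.
  - move=> x _ /=; rewrite lee_fin !normrM ler_wpM2r //.
    by apply: le_trans (gM x) _; exact: ler_norm.
  - by rewrite (_ : EFin \o _ = fun x => M%:E * (EFin \o q) x)%E //; exact: integrableZl.
(* The defining property of the density is that [L] kills indicators; each of the two terms is at
   most 1 on the unit ball. *)
pose L g := integ nu g - integ mu (fun x => g x * q x).
apply/eqP; rewrite -subr_eq0; apply/eqP; rewrite -[LHS]/(L f).
apply: (bmeas_functional_eq0 L 2) => //.
- move=> a g h bg bh; have bag : bmeas (fun x => a * g x).
    by apply: bmeasM => //; exact: bmeas_cst.
  rewrite /L (integD nu1) // (integZ nu1) //.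
  rewrite (_ : (fun x => _ * q x) =
    fun x => a * (g x * q x) + h x * q x); last by apply/funext => x; ring.
  have intag : mu.-integrable [set: T] (EFin \o (fun x => a * (g x * q x))).
    by under eq_fun do rewrite mulrA; exact: intfq.
  rewrite [integ mu _](@RintegralD _ _ _ mu setT) //; last exact: intfq.
  rewrite (@RintegralZl _ _ _ mu setT) //; last exact: intfq.
  by rewrite /Rintegral /integ /=; ring.
- move=> g bg g1; apply: le_trans (ler_normB _ _) _.
  rewrite -[2]/(1 + 1) lerD //; first exact: integ_normr_le.
  apply: le_trans (@le_normr_Rintegral _ _ _ mu setT _ measurableT (intfq _ bg)) _.
  have -> : 1 = Rintegral mu setT q by rewrite /Rintegral -nuq // nu1.
  apply: le_Rintegral => //.
    by apply: (integrable_norm (intfq _ bg)).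
  by move=> x _; rewrite normrM (ger0_norm (q0 x)) ler_piMl.
- move=> A mA; rewrite /L integ_indic // nuq // [in X in X - _]integral_mkcond.
  apply/eqP; rewrite subr_eq0; apply/eqP; congr fine.
  apply: eq_integral => x _; rewrite patchE indicE.
  by case: (x \in A); rewrite ?mul1r ?mul0r.
Qed.

End Density.

(** * The operator of a Markov kernel and its approximate Poisson equation *)

Section KernelOperator.
Context {R : realType} {d : measure_display} {T : measurableType d}.
Context (P : R.-pker T ~> T).
Implicit Types f g : T -> R.

Definition kop f : T -> R := fun x => integ (P x) f.

Lemma kop_normr_le (M : R) f : bmeas f -> (forall x, `|f x| <= M) ->
  forall x, `|kop f x| <= M.
Proof. by move=> bf fM x; apply: integ_normr_le => //; exact: prob_kernel. Qed.

Lemma kopB f g : bmeas f -> bmeas g ->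
  kop (fun x => f x - g x) = fun x => kop f x - kop g x.
Proof.
by move=> bf bg; apply/funext => x; apply: integB => //; exact: prob_kernel.
Qed.

Lemma kopD f g : bmeas f -> bmeas g ->
  kop (fun x => f x + g x) = fun x => kop f x + kop g x.
Proof.
by move=> bf bg; apply/funext => x; apply: integD => //; exact: prob_kernel.
Qed.

Lemma kopZ a f : bmeas f -> kop (fun x => a * f x) = fun x => a * kop f x.
Proof.
by move=> bf; apply/funext => x; apply: integZ => //; exact: prob_kernel.
Qed.

Lemma bmeas_kop f : bmeas f -> bmeas (kop f).
Proof.
move=> bf; have [mf [M fM]] := bf; split; last first.
  by exists M; exact: kop_normr_le.
have bc : bmeas (fun _ : T => M) by exact: bmeas_cst.
(* The shift by [M] makes the integrand nonnegative, as the measurability theorem for kernel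
   integrals requires. *)
rewrite (_ : kop f = fun x => kop (fun y => f y + M) x - M); last first.
  rewrite kopD //; apply/funext => x.
  by rewrite [kop (fun=> M) x]integ_cst ?addrK //; exact: prob_kernel.
apply: measurable_funB => //.
apply: (measurableT_comp (fine_measurable _)) => //.
apply: measurable_fun_integral_kernel => /=.
- by move=> U mU; exact: measurable_kernel.
- by move=> y; rewrite lee_fin; have := fM y; rewrite ler_norml; lra.
- by apply/measurable_EFinP; exact: measurable_funD.
Qed.

(** Stationarity is given on events, that is, for indicators; [bmeas_functional_eq0] carries it to
    bounded functions. *)
Lemma integ_kop (pi : probability T R) f :
  (forall A, measurable A -> (\int[pi]_x P x A = pi A)%E) ->
  bmeas f -> integ pi (kop f) = integ pi f.
Proof.
move=> stat bf; have pi1 := probability_setT pi.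
pose L g := integ pi (kop g) - integ pi g.
apply/eqP; rewrite -subr_eq0; apply/eqP; rewrite -[LHS]/(L f).
apply: (bmeas_functional_eq0 L 2) => //.
- move=> a g h bg bh; have bag : bmeas (fun x => a * g x).
    by apply: bmeasM => //; exact: bmeas_cst.
  have bkg := bmeas_kop _ bg; have bkh := bmeas_kop _ bh.
  have bkag : bmeas (fun x => a * kop g x).
    by apply: bmeasM => //; exact: bmeas_cst.
  rewrite /L kopD // kopZ // !(integD pi1) // !(integZ pi1) //; ring.
- move=> g bg g1; apply: le_trans (ler_normB _ _) _.
  rewrite -[2]/(1 + 1) lerD //; apply: integ_normr_le => //; first exact: bmeas_kop.
  exact: kop_normr_le.
- move=> A mA; rewrite /L integ_indic //; apply/eqP; rewrite subr_eq0; apply/eqP.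
  rewrite /integ; congr fine; rewrite -[RHS]stat //.
  apply: eq_integral => x _; rewrite /kop integ_indic //.
  rewrite fineK // ge0_fin_numE // (le_lt_trans _ (ltry 1)) //.
  by rewrite -(prob_kernel (s := P) x); apply: le_measure; rewrite ?inE.
Qed.

(* The partial sums of [g = \sum_j (1 - eps)^j P^j f], the solution of the
   Poisson equation common to all the kernels [(1 - eps) P + eps theta]. *)
Lemma approx_poisson (eps F delta : R) f : 0 < eps < 1 -> 0 < delta ->
  bmeas f -> (forall x, `|f x| <= F) ->
  exists g, [/\ bmeas g, forall x, `|g x| <= F / eps &
    forall x, `|f x - g x + (1 - eps) * kop g x| <= delta * F].
Proof.
move=> /andP[e0 e1] delta0 bf fF.
have F0 : 0 <= F by apply: le_trans (normr_ge0 _) (fF point).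
have bZ a g : bmeas g -> bmeas (fun x => a * g x).
  by move=> bg; apply: bmeasM => //; exact: bmeas_cst.
pose G := fix G N := if N is N'.+1 then
  (fun x => f x + (1 - eps) * kop (G N') x) else fun _ : T => 0.
have bG N : bmeas (G N).
  elim: N => [|N IHN] /=; first exact: bmeas_cst.
  by apply: bmeasD => //; apply/bZ/bmeas_kop.
(* [F / eps] is the fixed point of [c |-> F + (1 - eps) * c]. *)
have GF N x : `|G N x| <= F / eps.
  elim: N x => [|N IHN] x /=; first by rewrite normr0 divr_ge0 // ltW.
  apply: le_trans (ler_normD _ _) _; rewrite normrM (ger0_norm (_ : 0 <= 1 - eps)); last lra.
  have := kop_normr_le _ _ (bG N) IHN x; have := fF x.
  have h : F = F / eps * eps by rewrite divfK // gt_eqF.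
  rewrite {1}h; move: (F / eps) `|f x| `|kop _ _| => a b c.
  move=> ? ?; have : (1 - eps) * c <= (1 - eps) * a by apply: ler_wpM2l; lra.
  by lra.
(* This difference is exactly the residual of [G N] in the Poisson equation, and it contracts
   because [kop] does not increase the sup norm. *)
have GS N x : `|G N.+1 x - G N x| <= (1 - eps) ^+ N * F.
  elim: N x => [|N IHN] x.
    rewrite /= [kop _ _]integ_cst; last exact: prob_kernel.
    by rewrite mulr0 addr0 subr0 expr0 mul1r.
  rewrite [G N.+2]/= [X in _ - X]/= opprD addrACA subrr add0r -mulrBr.
  have /(congr1 (fun h => h x)) /= <- := kopB _ _ (bG N.+1) (bG N).
  rewrite exprS -mulrA normrM (ger0_norm (_ : 0 <= 1 - eps)); last lra.
  apply: ler_wpM2l; first lra.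
  by apply: kop_normr_le => //; apply: bmeasB (bG N.+1) (bG N).
have [N qN] : exists N, (1 - eps) ^+ N <= delta.
  have /cvgrPdist_lt /(_ _ delta0) [N _ /(_ N (leqnn _))] /= :
    ((1 - eps) ^+ n @[n --> \oo] --> (0 : R)).
    by apply: cvg_expr; rewrite ger0_norm; lra.
  by rewrite sub0r normrN => h; exists N; apply: le_trans (ler_norm _) (ltW h).
exists (G N); split => // x; rewrite addrAC.
by apply: le_trans (GS N x) _; exact: ler_wpM2r.
Qed.

End KernelOperator.

(** * Size and measurability of the importance-sampling estimate *)

Section Thetahat.
Context {R : realType} {d dO : measure_display}.
Context {T : measurableType d} {Om : measurableType dO}.
Context (w : T -> R) (y0 : T) (Y : nat -> Om -> T).
Context (w0 : forall x, 0 <= w x) (bw : bmeas w).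
Implicit Types f : T -> R.

Lemma bmeas_comp (V : Om -> T) f :
  measurable_fun [set: Om] V -> bmeas f -> bmeas (fun om => f (V om)).
Proof.
move=> mV [mf [M fM]]; split; first exact: measurableT_comp.
by exists M => om.
Qed.

Lemma thetahat_normr_le (F : R) n f om :
  (forall x, `|f x| <= F) -> `|thetahat w y0 Y n f om| <= F.
Proof.
move=> fF; have F0 : 0 <= F by apply: le_trans (normr_ge0 _) (fF point).
rewrite /thetahat; case: ifP => // _.
set S := \sum_(_ <= _ < _) w _.
have S0 : 0 <= S by apply: sumr_ge0.
(* If all weights vanish, division by zero makes the estimate 0, and the bound survives. Otherwise
   it is a weighted average. *)
move: S0; rewrite le_eqVlt => /predU1P[<-|S0].
  by rewrite invr0 mulr0 normr0.
rewrite normrM normfV (gtr0_norm S0) ler_pdivrMr // mulr_sumr.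
apply: le_trans (ler_norm_sum _ _ _) _; apply: ler_sum => i _.
by rewrite normrM (ger0_norm (w0 _)) mulrC ler_wpM2r.
Qed.

Lemma bmeas_thetahat n f :
  (forall k, (k <= n)%N -> measurable_fun [set: Om] (Y k)) ->
  bmeas f -> bmeas (thetahat w y0 Y n f).
Proof.
move=> mY bf; split; last first.
  have [_ [M fM]] := bf; exists M => om; exact: thetahat_normr_le.
rewrite /thetahat; case: (n == 0)%N; first exact: measurable_cst.
have bsum (g : T -> R) : bmeas g ->
    bmeas (fun om => \sum_(1 <= i < n.+1) g (Y i om)).
  move=> bg; apply: (@bmeas_sum _ _ _ _ _ (fun i om => g (Y i om))) => i.
  by rewrite mem_index_iota => /andP[_ ni]; apply: bmeas_comp => //; exact: mY.
(* Division becomes a power with exponent -1, for which measurability is known; the two agree on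
   nonnegative reals, also at 0. *)
rewrite (_ : (fun om => _) = (fun om => \sum_(1 <= i < n.+1) w (Y i om) * f (Y i om))
   \* (fun om => (\sum_(1 <= i < n.+1) w (Y i om)) `^ (-1))); last first.
  by apply/funext => om /=; rewrite powR_inv1 // sumr_ge0.
apply: measurable_funM; first exact: (bsum (fun x => w x * f x) (bmeasM _ _ bw bf)).1.
by apply: (measurableT_comp (measurable_powR _)); exact: (bsum _ bw).1.
Qed.

End Thetahat.

(** * Centered empirical means and the two suprema that enter [B_n] *)

Section EmpiricalMeasure.
Context {R : realType} {d dO : measure_display}.
Context {T : measurableType d} {Om : measurableType dO}.
Context (Pr : probability Om R) (piY : probability T R) (Y : nat -> Om -> T).
Context (mY : forall n, measurable_fun [set: Om] (Y n)).
Implicit Types (f g : T -> R) (n : nat).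

Let piY1 : piY [set: T] = 1%E := probability_setT piY.
Let Pr1 : Pr [set: Om] = 1%E := probability_setT Pr.
Let bc {d'} {T' : measurableType d'} (c : R) : bmeas (fun _ : T' => c) := bmeas_cst c.
Let bcM {d'} {T' : measurableType d'} (c : R) (f : T' -> R) :
  bmeas f -> bmeas (fun x => c * f x) := bmeasM _ _ (bc c).

Local Notation pihat := (pihatYbar piY Y).

Lemma bmeas_pihatYbar n f : bmeas f -> bmeas (pihat n f).
Proof.
move=> bf; apply: bmeasB; last exact: bc.
apply: bcM; apply: (@bmeas_sum _ _ _ _ _ (fun i om => f (Y i om))) => i _.
exact: bmeas_comp.
Qed.

Lemma pihatYbarD n f g om : bmeas f -> bmeas g ->
  pihat n (fun x => f x + g x) om = pihat n f om + pihat n g om.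
Proof.
by move=> bf bg; rewrite /pihatYbar (integD piY1) // big_split /=; ring.
Qed.

Lemma pihatYbarZ n (r : R) f om : bmeas f ->
  pihat n (fun x => r * f x) om = r * pihat n f om.
Proof. by move=> bf; rewrite /pihatYbar (integZ piY1) // -mulr_sumr; ring. Qed.

Lemma pihatYbar_cst n (r : R) om : (0 < n)%N -> pihat n (fun=> r) om = 0.
Proof.
move=> n0; rewrite /pihatYbar integ_cst // sumr_const_nat subSS subn0 -[r *+ n]mulr_natl.
by rewrite mulrA mulVf ?mul1r ?subrr // pnatr_eq0 -lt0n.
Qed.

Lemma pihatYbar_normr_le n f om : unit_ball_fun f -> `|pihat n f om| <= 2.
Proof.
move=> [mf f1]; have bf : bmeas f by split => //; exists 1.
apply: le_trans (ler_normB _ _) _; rewrite -[2]/(1 + 1) lerD //; last first.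
  exact: integ_normr_le.
case: n => [|n]; first by rewrite invr0 mul0r normr0.
rewrite normrM ger0_norm ?invr_ge0 // ler_pdivrMl ?ltr0Sn // mulr1.
apply: le_trans (ler_norm_sum _ _ _) _.
apply: (@le_trans _ _ (\sum_(1 <= i < n.+2) 1)); first exact: ler_sum.
by rewrite sumr_const_nat subSS subn0.
Qed.

Definition sup_mean n := sup [set Ex Pr (pihat n f) | f in unit_ball_fun].

Definition sup_square n :=
  sup [set Ex Pr (fun om => pihat n f om ^+ 2) | f in unit_ball_fun].

Lemma unit_ball_bmeas f : unit_ball_fun f -> bmeas f.
Proof. by move=> [mf f1]; split=> //; exists 1. Qed.

Lemma le_sup_mean n f : unit_ball_fun f -> Ex Pr (pihat n f) <= sup_mean n.
Proof.
move=> uf; apply: ub_le_sup; last by exists f.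
(* An upper bound must be exhibited: [sup] dominates the members of a set only if the set is bounded
   above. *)
exists 2 => _ [g ug <-]; apply: le_trans (ler_norm _) _.
apply: integ_normr_le => //; first exact/bmeas_pihatYbar/unit_ball_bmeas.
by move=> om; exact: pihatYbar_normr_le.
Qed.

Lemma le_sup_square n f : unit_ball_fun f ->
  Ex Pr (fun om => pihat n f om ^+ 2) <= sup_square n.
Proof.
move=> uf; apply: ub_le_sup; last by exists f.
exists 4 => _ [g ug <-]; apply: le_trans (ler_norm _) _.
apply: integ_normr_le => //.
  exact/bmeasX/bmeas_pihatYbar/unit_ball_bmeas.
move=> om; rewrite normrX (_ : 4 = 2 ^+ 2); last by rewrite -natrX.
by apply: lerXn2r; rewrite ?nnegrE //; exact: pihatYbar_normr_le.
Qed.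

Lemma sup_mean_ge0 n : 0 <= sup_mean n.
Proof.
have u0 : unit_ball_fun (fun _ : T => 0 : R).
  by split; [exact: measurable_cst | move=> x; rewrite normr0].
apply: le_trans (le_sup_mean n _ u0).
rewrite (_ : pihat n _ = fun=> 0) ?[leRHS]integ_cst //.
apply/funext => om; rewrite (_ : (fun _ : T => 0) = fun=> 0 * 0).
  by rewrite pihatYbarZ ?mul0r.
by rewrite mulr0.
Qed.

Lemma sup_square_ge0 n : 0 <= sup_square n.
Proof.
have u0 : unit_ball_fun (fun _ : T => 0 : R).
  by split; [exact: measurable_cst | move=> x; rewrite normr0].
by apply: le_trans (le_sup_square n _ u0); apply: integ_ge0 => om; exact: sqr_ge0.
Qed.

(* [pihatYbar] kills the constants, so only the oscillation matters. *)
Lemma pihatYbar_rescale n (c r : R) f : (0 < n)%N -> bmeas f ->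
  (forall x, `|f x - c| <= r) ->
  exists2 g, unit_ball_fun g & forall om, pihat n f om = r * pihat n g om.
Proof.
move=> n0 bf fr; pose g x := r^-1 * (f x - c).
have bg : bmeas g by apply: bcM; apply: bmeasB.
have r0 : 0 <= r by apply: le_trans (normr_ge0 _) (fr point).
(* For [r = 0] the inverse is 0 and [g] vanishes, but then [f] is the constant [c]. *)
have fE x : f x = r * g x + c.
  rewrite /g mulrA; have [re|rN] := eqVneq r 0; last by rewrite divff // mul1r subrK.
  by rewrite re mul0r mul0r add0r; apply/eqP; rewrite -subr_eq0 -normr_le0 -re.
exists g.
  split=> [|x]; first exact: bg.1.
  rewrite normrM normfV (ger0_norm r0).
  move: r0; rewrite le_eqVlt => /predU1P[<-|r0]; first by rewrite invr0 mul0r.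
  by rewrite ler_pdivrMl // mulr1.
move=> om; rewrite (_ : f = fun x => r * g x + c); last exact/funext.
rewrite pihatYbarD; [|exact: bcM|exact: bc].
by rewrite pihatYbarZ // pihatYbar_cst // addr0.
Qed.

(** The supremum is taken without absolute values; the symmetry [g |-> - g] of the unit ball
    supplies the lower bound. *)
Lemma mean_pihatYbar_le n (c r : R) f : (0 < n)%N -> bmeas f ->
  (forall x, `|f x - c| <= r) -> `|Ex Pr (pihat n f)| <= r * sup_mean n.
Proof.
move=> n0 bf fr; have r0 : 0 <= r by apply: le_trans (normr_ge0 _) (fr point).
have [g ug fE] := pihatYbar_rescale _ _ _ _ n0 bf fr.
have bg := unit_ball_bmeas _ ug.
rewrite (_ : pihat n f = fun om => r * pihat n g om); last exact/funext.
rewrite [Ex _ _](integZ Pr1); last exact: bmeas_pihatYbar.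
rewrite normrM (ger0_norm r0) ler_wpM2l // ler_norml le_sup_mean // andbT.
have ugN : unit_ball_fun (fun x => -1 * g x).
  split=> [|x]; first exact: (bcM _ _ bg).1.
  by rewrite mulN1r normrN ug.2.
rewrite lerNl; apply: le_trans (le_sup_mean n _ ugN).
rewrite (_ : pihat n (fun x => -1 * g x) = fun om => -1 * pihat n g om); last first.
  by apply/funext => om; rewrite pihatYbarZ.
by rewrite [leRHS](integZ Pr1) ?mulN1r //; exact: bmeas_pihatYbar.
Qed.

Lemma square_pihatYbar_le n (c r : R) f : (0 < n)%N -> bmeas f ->
  (forall x, `|f x - c| <= r) ->
  Ex Pr (fun om => pihat n f om ^+ 2) <= r ^+ 2 * sup_square n.
Proof.
move=> n0 bf fr; have [g ug fE] := pihatYbar_rescale _ _ _ _ n0 bf fr.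
have bg := unit_ball_bmeas _ ug.
rewrite (_ : (fun om => _) = fun om => r ^+ 2 * pihat n g om ^+ 2); last first.
  by apply/funext => om; rewrite fE exprMn.
rewrite [Ex _ _](integZ Pr1); last exact/bmeasX/bmeas_pihatYbar.
by rewrite ler_wpM2l ?sqr_ge0 // le_sup_square.
Qed.

End EmpiricalMeasure.

(** * Bias and mean square error of importance sampling *)

Section ImportanceSampling.
Context {R : realType} {d dO : measure_display}.
Context {T : measurableType d} {Om : measurableType dO}.
Context (Pr : probability Om R) (pi piY : probability T R) (Y : nat -> Om -> T).
Context (mY : forall n, measurable_fun [set: Om] (Y n)).
Context (w : T -> R) (W : R) (y0 : T).
Context (w0 : forall x, 0 <= w x) (wW : forall x, w x <= W) (bw : bmeas w).
Context (piE : forall f, bmeas f -> integ pi f = integ piY (fun x => w x * f x)).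
Implicit Types (f : T -> R) (n : nat).

Let Pr1 : Pr [set: Om] = 1%E := probability_setT Pr.
Let pi1 : pi [set: T] = 1%E := probability_setT pi.
Let bc {d'} {T' : measurableType d'} (c : R) : bmeas (fun _ : T' => c) := bmeas_cst c.
Let bcM {d'} {T' : measurableType d'} (c : R) (f : T' -> R) :
  bmeas f -> bmeas (fun x => c * f x) := bmeasM _ _ (bc c).

Local Notation pihat := (pihatYbar piY Y).
Local Notation theta := (thetahat w y0 Y).

Let W0 : 0 <= W := le_trans (w0 point) (wW point).

Lemma thetahat_error n f om : (0 < n)%N -> bmeas f ->
  theta n f om - integ pi f =
    pihat n (fun x => w x * f x) om - theta n f om * pihat n w om.
Proof.
move=> n0 bf; rewrite piE // /pihatYbar.
(* The case [f = 1] of the change of measure [piE]. *)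
have -> : integ piY w = 1.
  have := integ_cst pi1 1; rewrite piE //.
  by under eq_fun do rewrite mulr1.
suff <- : theta n f om * \sum_(1 <= i < n.+1) w (Y i om) =
    \sum_(1 <= i < n.+1) w (Y i om) * f (Y i om) by ring.
rewrite /thetahat eqn0Ngt n0 /=.
(* A zero sum of nonnegative weights forces each weight to be zero, so both sides vanish. *)
have [S0|SN] := eqVneq (\sum_(1 <= i < n.+1) w (Y i om)) 0; last by rewrite divfK.
rewrite S0 mulr0; apply/esym.
rewrite big_seq big1 // => i is1.
suff -> : w (Y i om) = 0 by rewrite mul0r.
apply/eqP; rewrite eq_le w0 andbT -S0 (bigD1_seq i) ?iota_uniq //=.
by rewrite lerDl sumr_ge0.
Qed.

Lemma IR_Bn_ge_square n :
  2 * W ^+ 2 * sup_square Pr piY Y n <= IR_Bn Pr piY W Y n.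
Proof. by rewrite lerDr mulr_ge0 // sup_mean_ge0. Qed.

Lemma IR_Bn_ge0 n : 0 <= IR_Bn Pr piY W Y n.
Proof.
apply: le_trans (IR_Bn_ge_square n).
by rewrite !mulr_ge0 ?sqr_ge0 // sup_square_ge0.
Qed.

(* Write [theta f - pi f = a - t b] with [t = theta f], [a = pihat (w f)],
   [b = pihat w].  Substituting [t = pi f + (a - t b)] once gives
   [pihat (w (f - pi f)) - a b + t b ^ 2]. *)
Lemma thetahat_bias n f : (0 < n)%N -> unit_ball_fun f ->
  `|Ex Pr (theta n f) - integ pi f| <= IR_Bn Pr piY W Y n.
Proof.
move=> n0 uf; have [mf f1] := uf; have bf := unit_ball_bmeas _ uf.
pose m := integ pi f.
have m1 : `|m| <= 1 by exact: integ_normr_le.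
pose a := pihat n (fun x => w x * f x); pose b := pihat n w.
(* The constant [m * W] is invisible to [pihat], so [u = a - m b]; it brings the bound on [|v|] down
   to [w + (W - w) = W]. *)
pose v x := w x * f x + m * (W - w x).
pose u := pihat n v.
have bwf : bmeas (fun x => w x * f x) by exact: bmeasM.
have bWw : bmeas (fun x => W - w x) by exact: bmeasB.
have bv : bmeas v by apply: bmeasD => //; exact: bcM.
have ba : bmeas a by exact: bmeas_pihatYbar.
have bb : bmeas b by exact: bmeas_pihatYbar.
have bu : bmeas u by exact: bmeas_pihatYbar.
have bth : bmeas (theta n f) by apply: bmeas_thetahat.
have uE om : u om = a om - m * b om.
  rewrite /u /v pihatYbarD //; last exact: bcM.
  rewrite pihatYbarZ // (_ : (fun x => W - w x) = fun x => W + -1 * w x).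
    rewrite pihatYbarD ?pihatYbarZ ?pihatYbar_cst -/a -/b //; first by ring.
    exact: bcM.
  by apply/funext => x; ring.
have Eu : `|Ex Pr u| <= W * sup_mean Pr piY Y n.
  apply: (mean_pihatYbar_le _ _ _ mY _ 0) => // x; rewrite subr0 /v.
  apply: le_trans (ler_normD _ _) _; rewrite !normrM (ger0_norm (w0 x)).
  have Ww0 : 0 <= W - w x by rewrite subr_ge0.
  rewrite (ger0_norm Ww0).
  by have := ler_wpM2l (w0 x) (f1 x); have := ler_wpM2r Ww0 m1; lra.
have Ea : Ex Pr (fun om => a om ^+ 2) <= W ^+ 2 * sup_square Pr piY Y n.
  apply: (square_pihatYbar_le _ _ _ mY _ 0) => // x; rewrite subr0.
  by rewrite normrM (ger0_norm (w0 x)) -[W]mulr1 ler_pM.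
have Eb : Ex Pr (fun om => b om ^+ 2) <= W ^+ 2 * sup_square Pr piY Y n.
  by apply: (square_pihatYbar_le _ _ _ mY _ 0) => // x; rewrite subr0 ger0_norm.
(* The remainder is [- a b + t b ^ 2] with [|t| <= 1]. The bound [|a b| <= (a ^ 2 + b ^ 2) / 2]
   gives the weights 1/2 and 3/2, whose sum is the 2 in [B_n]. *)
have ba2 := bmeasX _ 2 ba; have bb2 := bmeasX _ 2 bb.
have bq : bmeas (fun om => 2^-1 * a om ^+ 2 + 3 / 2 * b om ^+ 2).
  by apply: bmeasD; exact: bcM.
pose q := Ex Pr (fun om => 2^-1 * a om ^+ 2 + 3 / 2 * b om ^+ 2).
have Eq : q <= 2 * W ^+ 2 * sup_square Pr piY Y n.
  rewrite /q [Ex _ _](integD Pr1); try exact: bcM.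
  by rewrite !(integZ Pr1) // -!/(Ex _ _); lra.
have key om : `|theta n f om - m - u om| <= 2^-1 * a om ^+ 2 + 3 / 2 * b om ^+ 2.
  have D := thetahat_error n f om n0 bf; rewrite -/m -/a -/b in D.
  have -> : theta n f om - m - u om =
      - (a om * b om) + theta n f om * b om ^+ 2.
    rewrite uE; move: D; move: (theta n f om) (a om) (b om) => t a' b' D.
    have -> : m = t - (a' - t * b') by lra.
    by ring.
  apply: le_trans (ler_normD _ _) _; rewrite normrN [`|a om * b om|]normrM.
  rewrite [`|_ * b om ^+ 2|]normrM normrX.
  rewrite -[a om ^+ 2]real_normK ?num_real // -[b om ^+ 2]real_normK ?num_real //.
  have := thetahat_normr_le w y0 Y w0 1 n f om f1.
  move: `|a om| `|b om| `|theta n f om| => a' b' t t1'.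
  have := sqr_ge0 (a' - b'); have := sqr_ge0 b'; nra.
rewrite /IR_Bn -/(sup_mean _ _ _ _) -/(sup_square _ _ _ _).
have bthm : bmeas (fun om => theta n f om - m) by exact: bmeasB.
have -> : Ex Pr (theta n f) - integ pi f =
    Ex Pr (fun om => theta n f om - m - u om) + Ex Pr u.
  have -> : Ex Pr (fun om => theta n f om - m - u om) =
      Ex Pr (fun om => theta n f om - m) - Ex Pr u by exact: (integB Pr1).
  have -> : Ex Pr (fun om => theta n f om - m) = Ex Pr (theta n f) - m.
    by rewrite [LHS](integB Pr1) // integ_cst.
  by rewrite subrK.
rewrite addrC; apply: le_trans (ler_normD _ _) _; apply: lerD => //.
apply: le_trans Eq; rewrite ler_norml; apply/andP; split.
  rewrite -[- q]mulN1r -[leLHS](integZ Pr1) //.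
  apply: (le_integ Pr1); [exact: bcM|exact: bmeasB|move=> om].
  by rewrite mulN1r; have := key om; rewrite ler_norml => /andP[].
apply: (le_integ Pr1) => // [|om]; first exact: bmeasB.
by have := key om; rewrite ler_norml => /andP[].
Qed.

(** For [|t| <= F], [(a - t b) ^ 2 <= 3/2 a ^ 2 + 3 F ^ 2 b ^ 2]. Half of the [b ^ 2] term is joined
    with [a ^ 2] into [3/4 ((a + F b) ^ 2 + (a - F b) ^ 2)]. By oscillation, [a + F b] and [a - F b]
    cost no more than [a] alone, and [b] costs [W / 2]. The total is [3/2 + 3/8 = 15/8] times
    [F ^ 2 W ^ 2] times the supremum, and [B_n] contains twice [W ^ 2] times it. *)
Lemma thetahat_square_error n f (F : R) : (0 < n)%N -> bmeas f ->
  (forall x, `|f x| <= F) ->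
  Ex Pr (fun om => (theta n f om - integ pi f) ^+ 2) <=
    15 / 16 * F ^+ 2 * IR_Bn Pr piY W Y n.
Proof.
move=> n0 bf fF; have F0 : 0 <= F by apply: le_trans (normr_ge0 _) (fF point).
pose a := pihat n (fun x => w x * f x); pose b := pihat n w.
have bwf : bmeas (fun x => w x * f x) by exact: bmeasM.
have ba : bmeas a by exact: bmeas_pihatYbar.
have bb : bmeas b by exact: bmeas_pihatYbar.
have bth : bmeas (theta n f) by apply: bmeas_thetahat.
have Eab (e : R) : `|e| = 1 -> Ex Pr (fun om => (a om + e * F * b om) ^+ 2) <=
    (W * F) ^+ 2 * sup_square Pr piY Y n.
  move=> e1; have beF : bmeas (fun x => e * F * w x) by exact: bcM.
  rewrite (_ : (fun om => _) =
      fun om => pihat n (fun x => w x * f x + e * F * w x) om ^+ 2); last first.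
    by apply/funext => om; rewrite pihatYbarD // pihatYbarZ.
  apply: (square_pihatYbar_le _ _ _ mY _ (e * F * W)) => //.
    exact: bmeasD.
  (* Centering at [e * F * W] leaves at most [w F + F (W - w) = F W]. *)
  move=> x; rewrite (_ : _ - _ = w x * f x + e * F * (w x - W)); last by ring.
  apply: le_trans (ler_normD _ _) _; rewrite !normrM e1 mul1r (ger0_norm F0).
  have wW0 : w x - W <= 0 by rewrite subr_le0.
  rewrite (ger0_norm (w0 x)) (ler0_norm wW0).
  by have := ler_wpM2l (w0 x) (fF x); lra.
have Eb : Ex Pr (fun om => b om ^+ 2) <= (W / 2) ^+ 2 * sup_square Pr piY Y n.
  apply: (square_pihatYbar_le _ _ _ mY _ (W / 2)) => // x.
  by rewrite ler_norml; have := w0 x; have := wW x; lra.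
have bplus : bmeas (fun om => (a om + 1 * F * b om) ^+ 2).
  by apply/bmeasX/bmeasD => //; exact: bcM.
have bminus : bmeas (fun om => (a om + -1 * F * b om) ^+ 2).
  by apply/bmeasX/bmeasD => //; exact: bcM.
have bb2 := bmeasX _ 2 bb.
have Ep := Eab 1 (normr1 _); have Em := Eab (-1) (normrN1 _).
apply: (@le_trans _ _ (15 / 8 * F ^+ 2 * W ^+ 2 * sup_square Pr piY Y n)); last first.
  have := IR_Bn_ge_square n; have := sqr_ge0 F; nra.
apply: (@le_trans _ _ (3 / 4 * Ex Pr (fun om => (a om + 1 * F * b om) ^+ 2) +
    3 / 4 * Ex Pr (fun om => (a om + -1 * F * b om) ^+ 2) +
    3 / 2 * F ^+ 2 * Ex Pr (fun om => b om ^+ 2))); last first.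
  have := ler_wpM2l (sqr_ge0 F) Eb; move: Ep Em; rewrite !exprMn; nra.
rewrite /Ex -!(integZ Pr1) // -!(integD Pr1); try do ?[apply: bmeasD|apply: bcM] => //.
apply: (le_integ Pr1).
- by apply/bmeasX/bmeasB.
- by do ?[apply: bmeasD|apply: bcM].
move=> om; rewrite thetahat_error // -/a -/b.
have := thetahat_normr_le w y0 Y w0 F n f om fF.
move: (theta n f om) (a om) (b om) => t a' b' tF.
have t2 : t ^+ 2 <= F ^+ 2.
  by rewrite -[t ^+ 2]real_normK ?num_real // lerXn2r ?nnegrE.
have : t ^+ 2 * b' ^+ 2 <= F ^+ 2 * b' ^+ 2 by rewrite ler_wpM2r ?sqr_ge0.
(* Half of this square is the gap in [(a - t b) ^ 2 <= 3/2 a ^ 2 + 3 t ^ 2 b ^ 2]. *)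
have := sqr_ge0 (a' + 2 * t * b'); nra.
Qed.

End ImportanceSampling.

(** * Cauchy-Schwarz and Minkowski inequalities *)

Section L2.
Context {R : realType} {d : measure_display} {Om : measurableType d}.
Context (Pr : probability Om R).
Implicit Types U V : Om -> R.

Let Pr1 : Pr [set: Om] = 1%E := probability_setT Pr.
Let bcM {d'} {T' : measurableType d'} (c : R) (f : T' -> R) :
  bmeas f -> bmeas (fun x => c * f x) := bmeasM _ _ (bmeas_cst c).

Lemma Ex_mul_le U V (u v : R) : bmeas U -> bmeas V -> 0 <= u -> 0 <= v ->
  Ex Pr (fun x => U x ^+ 2) <= u ^+ 2 -> Ex Pr (fun x => V x ^+ 2) <= v ^+ 2 ->
  Ex Pr (fun x => U x * V x) <= u * v.
Proof.
move=> bU bV u0 v0 EU EV.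
have bU2 := bmeasX _ 2 bU; have bV2 := bmeasX _ 2 bV; have bUV := bmeasM _ _ bU bV.
pose e := Ex Pr (fun x => U x * V x).
have young (s t : R) : 2 * (s * t) * e <= s ^+ 2 * u ^+ 2 + t ^+ 2 * v ^+ 2.
  apply: (@le_trans _ _ (Ex Pr (fun x => s ^+ 2 * U x ^+ 2 + t ^+ 2 * V x ^+ 2))).
    rewrite /e /Ex -(integZ Pr1) //; apply: (le_integ Pr1) => [| |x].
    - exact: bcM.
    - by apply: bmeasD; exact: bcM.
    - by have := sqr_ge0 (s * U x - t * V x); nra.
  rewrite [leLHS](integD Pr1); try exact: bcM.
  by rewrite !(integZ Pr1) //; apply: lerD; rewrite ler_wpM2l // sqr_ge0.
rewrite -/e leNgt; apply/negP => euv.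
have e0 : 0 < e by apply: le_lt_trans euv; exact: mulr_ge0.
have eK c : c / e * e = c by rewrite divfK // gt_eqF.
move: u0 v0; rewrite !le_eqVlt => /predU1P[u0|u0] /predU1P[v0|v0].
- by have := young 1 1; rewrite -u0 -v0; nra.
(* With [u = 0] the factor of [U] is free; this choice turns the inequality into
   [2 (v ^ 2 + 1) <= v ^ 2]. *)
- have := young ((v ^+ 2 + 1) / e) 1; rewrite -u0 mulr1 -mulrA eK.
  by have := sqr_ge0 v; nra.
- have := young 1 ((u ^+ 2 + 1) / e); rewrite -v0 mul1r -mulrA eK.
  by have := sqr_ge0 u; nra.
- have := young v u; have uv0 := mulr_gt0 u0 v0.
  have : 0 < (u * v) * (e - u * v) by rewrite mulr_gt0 // subr_gt0.
  by nra.
Qed.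

Lemma Ex_sqrD_le U V (u v : R) : bmeas U -> bmeas V -> 0 <= u -> 0 <= v ->
  Ex Pr (fun x => U x ^+ 2) <= u ^+ 2 -> Ex Pr (fun x => V x ^+ 2) <= v ^+ 2 ->
  Ex Pr (fun x => (U x + V x) ^+ 2) <= (u + v) ^+ 2.
Proof.
move=> bU bV u0 v0 EU EV.
have bU2 := bmeasX _ 2 bU; have bV2 := bmeasX _ 2 bV; have bUV := bmeasM _ _ bU bV.
have b2UV : bmeas (fun x => 2 * (U x * V x)) by exact: bcM.
rewrite (_ : (fun x => _) = fun x => U x ^+ 2 + 2 * (U x * V x) + V x ^+ 2); last first.
  by apply/funext => x; ring.
rewrite [leLHS](integD Pr1) //; last exact: bmeasD.
rewrite (integD Pr1) // (integZ Pr1) // -!/(Ex Pr _).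
by have := Ex_mul_le _ _ _ _ bU bV u0 v0 EU EV; lra.
Qed.

Lemma Ex_sqr_sum_le (I : eqType) (s : seq I) (D : I -> Om -> R) (c : I -> R) :
  (forall i, i \in s -> bmeas (D i)) -> (forall i, 0 <= c i) ->
  (forall i, i \in s -> Ex Pr (fun x => D i x ^+ 2) <= c i ^+ 2) ->
  Ex Pr (fun x => (\sum_(i <- s) D i x) ^+ 2) <= (\sum_(i <- s) c i) ^+ 2.
Proof.
move=> bD c0; elim: s bD => [|i s IHs] bD Dc.
  rewrite big_nil (_ : (fun x => _) = fun=> 0); first by rewrite [leLHS]integ_cst ?expr0n.
  by apply/funext => x; rewrite big_nil expr0n.
have bDs j : j \in s -> bmeas (D j) by move=> js; apply: bD; rewrite in_cons js orbT.
rewrite big_cons (_ : (fun x => _) = fun x => (D i x + \sum_(j <- s) D j x) ^+ 2).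
  apply: Ex_sqrD_le; rewrite ?sumr_ge0 //.
  - by apply: bD; rewrite mem_head.
  - exact: bmeas_sum.
  - by apply: Dc; rewrite mem_head.
  - by apply: IHs => // j js; apply: Dc; rewrite in_cons js orbT.
by apply/funext => x; rewrite big_cons.
Qed.

End L2.

(** * The chain: one-step conditional means *)

Section Process.
Context {R : realType} {d dO : measure_display}.
Context {T : measurableType d} {Om : measurableType dO}.
Context (Pr : probability Om R) (P : R.-pker T ~> T).
Context (X Y : nat -> Om -> T) (Z : nat -> set Om) (w : T -> R) (y0 : T) (eps : R).
Context (mX : forall n, measurable_fun [set: Om] (X n)).
Context (mY : forall n, measurable_fun [set: Om] (Y n)).
Context (mZ : forall n, measurable (Z n)).
Context (w0 : forall x, 0 <= w x) (bw : bmeas w) (eps01 : 0 < eps < 1).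
Context (PrZ : forall n, Pr (Z n.+1) = eps%:E).
Context (indepZ : forall n, indep_event Pr (Z n.+1) (F_allY_XY X Y n)).
Context (condX : forall n (f : T -> R), measurable_fun [set: T] f -> bounded_fun f ->
  cond_exp Pr (F_XYZ X Y n (Z n.+1)) (f \o X n.+1)
    (fun om => if `[< Z n.+1 om >] then thetahat w y0 Y n f om
               else integ (P (X n om)) f)).
Implicit Types f g : T -> R.

Let Pr1 : Pr [set: Om] = 1%E := probability_setT Pr.
Let bcM {d'} {T' : measurableType d'} (c : R) (f : T' -> R) :
  bmeas f -> bmeas (fun x => c * f x) := bmeasM _ _ (bmeas_cst c).

Local Notation theta := (thetahat w y0 Y).

(** The generating family of [F_XY X Y n], kept apart because [g_sigma_algebraType] takes
    generators: adaptedness becomes measurability on the type [hist n]. *)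
Definition history n : set (set Om) :=
  [set A | exists k, (k <= n)%N /\ (Defs.preim (X k) A \/ Defs.preim (Y k) A)].

Local Notation hist n := (g_sigma_algebraType (history n)).

Lemma preim_measurable (V : Om -> T) (A : set Om) :
  measurable_fun [set: Om] V -> Defs.preim V A -> measurable A.
Proof. by move=> mV [B mB <-]; rewrite -[_ @^-1` _]setTI; exact: mV. Qed.

Lemma history_measurable n : <<s history n >> `<=` measurable.
Proof.
apply: smallest_sub; first exact: sigma_algebra_measurable.
by move=> A [k [_ [|]]]; exact: preim_measurable.
Qed.

Lemma measurable_X_history k n : (k <= n)%N ->
  measurable_fun [set: hist n] (X k : hist n -> T).
Proof.
move=> kn _ B mB; rewrite setTI; apply: sub_sigma_algebra.
by exists k; split => //; left; exists B.
Qed.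

Lemma measurable_Y_history k n : (k <= n)%N ->
  measurable_fun [set: hist n] (Y k : hist n -> T).
Proof.
move=> kn _ B mB; rewrite setTI; apply: sub_sigma_algebra.
by exists k; split => //; right; exists B.
Qed.

Definition step n f (om : Om) : R :=
  (1 - eps) * kop P f (X n om) + eps * theta n f om.

Lemma bmeas_step_history k n f : (k <= n)%N -> bmeas f ->
  bmeas (step k f : hist n -> R).
Proof.
move=> kn bf; apply: bmeasD; apply: bcM.
  apply: (@bmeas_comp _ _ _ _ (hist n)); first exact: measurable_X_history.
  exact: bmeas_kop.
apply: (@bmeas_thetahat _ _ _ _ (hist n)) => // j jk.
by apply: measurable_Y_history; exact: leq_trans kn.
Qed.

Lemma bmeas_step n f : bmeas f -> bmeas (step n f).
Proof.
move=> bf; apply: (bmeas_ambient (history n)); first exact: history_measurable.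
exact: bmeas_step_history.
Qed.

(** [condX] conditions on the past and on [Z n.+1]. Multiplied by a function of the past, the
    indicator of [Z n.+1] then averages to [eps] by independence. *)
Lemma step_cond_exp n f (phi : Om -> R) : bmeas f ->
  bmeas (phi : hist n -> R) ->
  Ex Pr (fun om => f (X n.+1 om) * phi om) = Ex Pr (fun om => step n f om * phi om).
Proof.
move=> bf bphi; have bphi' := bmeas_ambient _ _ (history_measurable n) bphi.
pose GZ : set (set Om) := [set A | (exists k, (k <= n)%N /\
  (Defs.preim (X k) A \/ Defs.preim (Y k) A)) \/ A = Z n.+1].
pose GY : set (set Om) := [set A | (exists k, Defs.preim (Y k) A) \/
  (exists k, (k <= n)%N /\ Defs.preim (X k) A)].
have GZm : <<s GZ >> `<=` measurable.
  apply: smallest_sub; first exact: sigma_algebra_measurable.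
  by move=> A [[k [_ [|]]]|->] //; exact: preim_measurable.
have GYm : <<s GY >> `<=` measurable.
  apply: smallest_sub; first exact: sigma_algebra_measurable.
  by move=> A [[k]|[k [_]]]; exact: preim_measurable.
have hZ : <<s history n >> `<=` <<s GZ >>.
  apply: smallest_sub; first exact: smallest_sigma_algebra.
  by move=> A hA; apply: sub_sigma_algebra; left.
have hY : <<s history n >> `<=` <<s GY >>.
  apply: smallest_sub; first exact: smallest_sigma_algebra.
  move=> A [k [kn [hX|hY]]]; apply: sub_sigma_algebra.
    by right; exists k.
  by left; exists k.
have bk := bmeas_kop P _ bf.
have bfX : bmeas (fun om => f (X n.+1 om)) by exact: bmeas_comp.
have bkX : bmeas (fun om => kop P f (X n om)) by exact: bmeas_comp.
have bth : bmeas (theta n f) by apply: bmeas_thetahat.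
have bZ : bmeas (\1_(Z n.+1) : Om -> R) by exact: bmeas_indic.
(* The case distinction of [condX], rewritten as an expression affine in the indicator. *)
pose V om := \1_(Z n.+1) om * theta n f om +
  (kop P f (X n om) - \1_(Z n.+1) om * kop P f (X n om)).
have bV : bmeas V.
  apply: bmeasD; first exact: bmeasM.
  by apply: bmeasB => //; exact: bmeasM.
have condV : cond_exp Pr <<s GZ >> (fun om => f (X n.+1 om)) V.
  have [_ [M fM]] := bf.
  have := condX n f bf.1; rewrite (_ : (fun om => if _ then _ else _) = V).
    by apply; apply/bounded_funP; exists M.
  apply/funext => om; rewrite /V indicE -/(kop P f _).
  case: asboolP => [Zom|nZ].
    by rewrite (_ : om \in Z n.+1 = true) ?mem_set //= !mul1r subrr addr0.
  by rewrite (_ : om \in Z n.+1 = false) ?memNset //= !mul0r add0r subr0.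
rewrite (cond_exp_mul Pr _ _ _ _ GZm bfX bV condV); last exact: bmeas_sub bphi.
have indE (psi : Om -> R) : bmeas (psi : hist n -> R) ->
    Ex Pr (fun om => \1_(Z n.+1) om * psi om) = eps * Ex Pr psi.
  move=> bpsi; rewrite (indep_event_mul Pr GY) ?PrZ //.
  exact: bmeas_sub bpsi.
have bthp : bmeas ((fun om => theta n f om * phi om) : hist n -> R).
  apply: bmeasM => //; apply: (@bmeas_thetahat _ _ _ _ (hist n)) => // k.
  exact: measurable_Y_history.
have bkXp : bmeas ((fun om => kop P f (X n om) * phi om) : hist n -> R).
  apply: bmeasM => //; apply: (@bmeas_comp _ _ _ _ (hist n)) => //.
  exact: measurable_X_history.
have bthp' := bmeas_ambient _ _ (history_measurable n) bthp.
have bkXp' := bmeas_ambient _ _ (history_measurable n) bkXp.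
have b1 : bmeas (fun om => \1_(Z n.+1) om * (theta n f om * phi om)) by exact: bmeasM.
have b2 : bmeas (fun om => \1_(Z n.+1) om * (kop P f (X n om) * phi om)) by exact: bmeasM.
rewrite (_ : (fun om => V om * phi om) = fun om =>
    \1_(Z n.+1) om * (theta n f om * phi om) + (kop P f (X n om) * phi om -
    \1_(Z n.+1) om * (kop P f (X n om) * phi om))); last first.
  by apply/funext => om; rewrite /V; ring.
rewrite [LHS](integD Pr1) //; last exact: bmeasB.
rewrite (integB Pr1) // -!/(Ex Pr _) !indE //.
rewrite (_ : (fun om => step n f om * phi om) = fun om =>
    eps * (theta n f om * phi om) + (1 - eps) * (kop P f (X n om) * phi om)); last first.
  by apply/funext => om; rewrite /step; ring.
rewrite [RHS](integD Pr1); try exact: bcM.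
by rewrite !(integZ Pr1) // -!/(Ex Pr _); ring.
Qed.

Lemma Ex_step n f : bmeas f -> Ex Pr (f \o X n.+1) =
  (1 - eps) * Ex Pr (kop P f \o X n) + eps * Ex Pr (theta n f).
Proof.
move=> bf; have := step_cond_exp n f (fun=> 1) bf (bmeas_cst 1).
under eq_fun do rewrite mulr1; move=> ->.
under eq_fun do rewrite mulr1.
rewrite [LHS](integD Pr1) ?(integZ Pr1) //; try apply: bcM.
- by apply: bmeas_comp => //; exact: bmeas_kop.
- by apply: bmeas_thetahat.
- by apply: bmeas_comp => //; exact: bmeas_kop.
- by apply: bmeas_thetahat.
Qed.

(** * Martingale increments and their orthogonality *)

Definition increment f n (om : Om) : R := f (X n.+1 om) - step n f om.

Lemma bmeas_increment_history k n f : (k < n)%N -> bmeas f ->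
  bmeas (increment f k : hist n -> R).
Proof.
move=> kn bf; apply: bmeasB; last by apply: bmeas_step_history => //; exact: ltnW.
by apply: (@bmeas_comp _ _ _ _ (hist n)) => //; exact: measurable_X_history.
Qed.

Lemma increment_orthogonal n f (phi : Om -> R) : bmeas f ->
  bmeas (phi : hist n -> R) -> Ex Pr (fun om => increment f n om * phi om) = 0.
Proof.
move=> bf bphi; have bphi' := bmeas_ambient _ _ (history_measurable n) bphi.
rewrite (_ : (fun om => _) = fun om => f (X n.+1 om) * phi om - step n f om * phi om).
  rewrite [LHS](integB Pr1) -!/(Ex Pr _) ?step_cond_exp ?subrr //.
  - by apply: bmeasM => //; exact: bmeas_comp.
  - by apply: bmeasM => //; exact: bmeas_step.
by apply/funext => om; rewrite mulrBl.
Qed.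

Lemma bmeas_increment n f : bmeas f -> bmeas (increment f n).
Proof.
by move=> bf; apply: bmeasB; [exact: bmeas_comp|exact: bmeas_step].
Qed.

(** Pythagoras: the increment is orthogonal to [step], so its second moment is that of [f (X n.+1)]
    minus that of [step]. *)
Lemma increment_square n f (M : R) : bmeas f -> (forall x, `|f x| <= M) ->
  Ex Pr (fun om => increment f n om ^+ 2) <= M ^+ 2.
Proof.
move=> bf fM; have bs := bmeas_step n _ bf; have bi := bmeas_increment n _ bf.
have bis : bmeas (fun om => increment f n om * step n f om) by exact: bmeasM.
have bi2 : bmeas (fun om => increment f n om ^+ 2) by exact: bmeasX.
have b2is : bmeas (fun om => 2 * (increment f n om * step n f om)) by exact: bcM.
have -> : Ex Pr (fun om => increment f n om ^+ 2) =
    Ex Pr (fun om => increment f n om ^+ 2 + 2 * (increment f n om * step n f om)).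
  rewrite [RHS](integD Pr1) // (integZ Pr1) // -!/(Ex Pr _).
  rewrite increment_orthogonal ?mulr0 ?addr0 //; exact: bmeas_step_history.
rewrite -[leRHS](integ_cst Pr1); apply: (le_integ Pr1) => [| |om].
- exact: bmeasD.
- exact: bmeas_cst.
- have : `|f (X n.+1 om)| ^+ 2 <= M ^+ 2.
    by rewrite lerXn2r ?nnegrE // (le_trans _ (fM point)).
  rewrite real_normK ?num_real // /increment.
  have := sqr_ge0 (step n f om); lra.
Qed.

Lemma martingale_square n f (M : R) : bmeas f -> (forall x, `|f x| <= M) ->
  Ex Pr (fun om => (\sum_(0 <= i < n) increment f i om) ^+ 2) <= n%:R * M ^+ 2.
Proof.
move=> bf fM; elim: n => [|n IHn].
  rewrite mul0r (_ : (fun om => _) = fun=> 0) ?[leLHS]integ_cst //.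
  by apply/funext => om; rewrite big_geq // expr0n.
pose S om := \sum_(0 <= i < n) increment f i om.
have bSh : bmeas (S : hist n -> R).
  apply: (@bmeas_sum _ _ (hist n)) => i.
  by rewrite mem_index_iota => /andP[_ ni]; exact: bmeas_increment_history.
have bS := bmeas_ambient _ _ (history_measurable n) bSh.
have bi := bmeas_increment n _ bf.
have biS : bmeas (fun om => increment f n om * S om) by exact: bmeasM.
have b2iS : bmeas (fun om => 2 * (increment f n om * S om)) by exact: bcM.
have bS2 := bmeasX _ 2 bS; have bi2 := bmeasX _ 2 bi.
rewrite (_ : (fun om => _) = fun om =>
    S om ^+ 2 + 2 * (increment f n om * S om) + increment f n om ^+ 2); last first.
  by apply/funext => om; rewrite big_nat_recr //= -/(S om); ring.
rewrite [leLHS](integD Pr1) //; last exact: bmeasD.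
rewrite (integD Pr1) // (integZ Pr1) // -!/(Ex Pr _).
rewrite increment_orthogonal // mulr0 addr0 -natr1 mulrDl mul1r.
by apply: lerD => //; exact: increment_square.
Qed.

(** * Error bounds for the chain *)

Context (pi piY : probability T R) (W : R) (wW : forall x, w x <= W).
Context (piE : forall f, bmeas f -> integ pi f = integ piY (fun x => w x * f x)).
Context (stat : forall A, measurable A -> (\int[pi]_x P x A = pi A)%E).

Let pi1 : pi [set: T] = 1%E := probability_setT pi.

Local Notation B := (IR_B Pr piY W Y).

Lemma IR_B_ge0 n : 0 <= B n.
Proof. by case: n => [|n]; [exact: ler01|exact: IR_Bn_ge0]. Qed.

(** By stationarity the bias of [f] at time [n + 1] is [1 - eps] times that of [kop P f] at time
    [n], plus [eps] times the bias of [theta n]; [kop P f] stays in the unit ball. The factor 2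
    cancels the 1/2 in [tv_law]. *)
Lemma law_error n f : unit_ball_fun f ->
  `|Ex Pr (f \o X n) - integ pi f| <=
    2 * \sum_(0 <= l < n.+1) (1 - eps) ^+ (n - l) * IR_Bm1 Pr piY W Y l.
Proof.
have /andP[e0 e1] := eps01; have e1' : 0 <= 1 - eps by lra.
have trivial (a : R) g : `|a| <= 1 -> unit_ball_fun g -> `|a - integ pi g| <= 2.
  move=> a1 ug; apply: le_trans (ler_normB _ _) _.
  rewrite -[2]/(1 + 1) lerD //; apply: integ_normr_le ug.2 => //.
  exact: unit_ball_bmeas.
elim: n f => [|n IHn] f uf; have bf := unit_ball_bmeas _ uf.
  rewrite big_nat1 subnn expr0 mul1r mulr1; apply: trivial => //.
  apply: integ_normr_le => // [|om]; [exact: bmeas_comp|exact: uf.2].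
have uk : unit_ball_fun (kop P f).
  split; first exact: (bmeas_kop P _ bf).1.
  by apply: kop_normr_le => //; exact: uf.2.
rewrite Ex_step // -{1}(integ_kop P _ _ stat bf).
rewrite (_ : _ - _ = (1 - eps) * (Ex Pr (kop P f \o X n) - integ pi (kop P f)) +
    eps * (Ex Pr (theta n f) - integ pi f)); last first.
  by rewrite (integ_kop P) //; ring.
rewrite big_nat_recr //= subnn expr0 mul1r [leRHS]mulrDr.
apply: le_trans (ler_normD _ _) _; apply: lerD.
  rewrite normrM (ger0_norm e1').
  rewrite (_ : \sum_(0 <= l < n.+1) _ = (1 - eps) *
      \sum_(0 <= l < n.+1) (1 - eps) ^+ (n - l) * IR_Bm1 Pr piY W Y l).
    by rewrite mulrCA; apply: ler_wpM2l => //; exact: IHn.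
  rewrite mulr_sumr; apply: eq_big_nat => l /andP[_ ln].
  by rewrite subSn // exprS mulrA.
rewrite normrM (gtr0_norm e0) -[IR_Bm1 _ _ _ _ n.+1]/(B n).
have Bn0 := IR_B_ge0 n.
(* [theta 0] is evaluation at [y0], with no sampling bound: the trivial bound 2 is [2 * B 0]. *)
case: n {IHn} Bn0 => [|n] Bn0.
  have h : `|Ex Pr (theta 0 f) - integ pi f| <= 2.
    by apply: trivial => //; rewrite [Ex _ _]integ_cst //; exact: uf.2.
  by rewrite -[B 0]/(1 : R); have := ler_wpM2l (ltW e0) h; lra.
have h := thetahat_bias Pr pi piY Y mY w W y0 w0 wW bw piE n.+1 f isT uf.
rewrite -[IR_Bn _ _ _ _ _]/(B n.+1) in h.
by have := ler_wpM2l (ltW e0) h; nra.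
Qed.

(* With [g] an approximate solution of the Poisson equation, the sum is a
   martingale, plus boundary terms, plus the sampling errors
   [eps (theta_k g - pi g)]; the weights 24, 48, 16/15 balance the three. *)
Lemma sum_square_error n f (F : R) : (0 < n)%N -> bmeas f ->
  (forall x, `|f x| <= F) ->
  Ex Pr (fun om => (\sum_(1 <= i < n.+1) (f (X i om) - integ pi f)) ^+ 2) <=
    (80 + 64 * n%:R) * (F / eps) ^+ 2 +
    F ^+ 2 * (\sum_(0 <= k < n) Num.sqrt (B k)) ^+ 2.
Proof.
move=> n0 bf fF; have F0 : 0 <= F by apply: le_trans (normr_ge0 _) (fF point).
have /andP[e0 e1] := eps01; have e1' : 0 <= 1 - eps by lra.
have Fe : F <= F / eps.
  by rewrite ler_pdivlMr // ler_piMr // ltW.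
have Fe2 : F ^+ 2 <= (F / eps) ^+ 2.
  by rewrite lerXn2r ?nnegrE // (le_trans F0).
have sq0 : 0 <= F ^+ 2 * (\sum_(0 <= k < n) Num.sqrt (B k)) ^+ 2.
  by rewrite mulr_ge0 // sqr_ge0.
have bfX i : bmeas (fun om => f (X i om)) by exact: bmeas_comp.
have centered (h : T -> R) (M : R) x : bmeas h -> (forall y, `|h y| <= M) ->
    `|h x - integ pi h| <= 2 * M.
  move=> bh hM; apply: le_trans (ler_normB _ _) _.
  rewrite (_ : 2 * M = M + M); last by ring.
  by apply: lerD => //; exact: integ_normr_le.
(* The weights used below give [24 * (21/10)^2 + 48 n], which is at most [80 + 64 n] only from
   [n = 2] on. For [n = 1] the trivial bound [(2 F) ^ 2] suffices. *)
have [->|n2] := eqVneq n 1%N.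
  rewrite (_ : (fun om => _) = fun om => (f (X 1%N om) - integ pi f) ^+ 2); last first.
    by apply/funext => om; rewrite big_nat1.
  apply: (@le_trans _ _ ((2 * F) ^+ 2)).
    rewrite -[leRHS](integ_cst Pr1); apply: (le_integ Pr1) => [| |om].
    - by apply/bmeasX/bmeasB => //; exact: bmeas_cst.
    - exact: bmeas_cst.
    - rewrite -[leLHS]real_normK ?num_real // lerXn2r ?nnegrE //.
        exact: mulr_ge0.
      exact: centered.
  have := sqr_ge0 (\sum_(0 <= k < 1) Num.sqrt (B k)).
  have := sqr_ge0 F; nra.
have n1 : 2 <= n%:R :> R by rewrite ler_nat ltn_neqAle eq_sym n2.
(* The [n] centered residuals, each at most [2 * delta * F], then add up to at most [F / 10]. *)
pose delta : R := (20 * n%:R)^-1.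
have delta0 : 0 < delta by rewrite invr_gt0 mulr_gt0 //; lra.
have [g [bg gF fg]] := approx_poisson P eps F delta f eps01 delta0 bf fF.
pose r x := f x - g x + (1 - eps) * kop P g x.
have bk := bmeas_kop P _ bg.
have bek : bmeas (fun x => (1 - eps) * kop P g x) by exact: bcM.
have bfg : bmeas (fun x => f x - g x) by exact: bmeasB.
have br : bmeas r by exact: bmeasD.
have pir : integ pi f = eps * integ pi g + integ pi r.
  by rewrite /r (integD pi1) // (integB pi1) // (integZ pi1) // integ_kop //; ring.
have bth k : bmeas (theta k g) by apply: bmeas_thetahat.
pose M om := \sum_(0 <= i < n) increment g i om.
(* The term [k = 0] goes into the bounded part [b], since the mean square estimate of [theta k]
   needs [0 < k]. *)
pose Q om := \sum_(1 <= k < n) eps * (theta k g om - integ pi g).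
pose b om := (1 - eps) * (kop P g (X 0 om) - kop P g (X n om)) +
  \sum_(1 <= i < n.+1) (r (X i om) - integ pi r) +
  eps * (theta 0 g om - integ pi g).
have bc (c : R) : bmeas (fun _ : Om => c) by exact: bmeas_cst.
have bM : bmeas M by apply: bmeas_sum => i _; exact: bmeas_increment.
have bQk k : bmeas (fun om => eps * (theta k g om - integ pi g)).
  by apply/bcM/bmeasB.
have bQ : bmeas Q by apply: bmeas_sum => k _; exact: bQk.
have decomp om : \sum_(1 <= i < n.+1) (f (X i om) - integ pi f) = b om + M om + Q om.
  have full m : \sum_(1 <= i < m.+1) (f (X i om) - integ pi f) =
      (1 - eps) * (kop P g (X 0 om) - kop P g (X m om)) +
      \sum_(1 <= i < m.+1) (r (X i om) - integ pi r) +
      \sum_(0 <= i < m) increment g i om +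
      \sum_(0 <= k < m) eps * (theta k g om - integ pi g).
    elim: m => [|m IHm]; first by rewrite !big_geq // subrr mulr0 !addr0.
    rewrite big_nat_recr //= IHm (@big_nat_recr _ _ _ m.+1 1) //=.
    rewrite !(@big_nat_recr _ _ _ m 0) //=.
    by rewrite pir /increment /step /r; ring.
  by rewrite full [X in _ + X = _]big_ltn // /b /M /Q; ring.
(* The boundary terms and the [theta 0] term give [2 (1 - eps) + 2 eps = 2]; the residuals give the
   1/10. *)
have bbd om : `|b om| <= 21 / 10 * (F / eps).
  rewrite (_ : 21 / 10 * (F / eps) = (1 - eps) * (2 * (F / eps)) +
      F / eps / 10 + eps * (2 * (F / eps))); last by field; exact: lt0r_neq0.
  apply: le_trans (ler_normD _ _) _; apply: lerD; last first.
    rewrite normrM (gtr0_norm e0) ler_wpM2l ?(ltW e0) //; exact: centered.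
  apply: le_trans (ler_normD _ _) _; apply: lerD.
    rewrite normrM (ger0_norm e1') ler_wpM2l //.
    apply: le_trans (ler_normB _ _) _.
    by have := kop_normr_le P _ _ bg gF (X 0 om); have := kop_normr_le P _ _ bg gF (X n om); lra.
  apply: (@le_trans _ _ (F / 10)); last by lra.
  apply: le_trans (ler_norm_sum _ _ _) _.
  apply: (@le_trans _ _ (\sum_(1 <= i < n.+1) 2 * (delta * F))).
    by apply: ler_sum => i _; exact: centered.
  rewrite sumr_const_nat subSS subn0 -[_ *+ n]mulr_natl /delta.
  rewrite (_ : n%:R * _ = F / 10) //; field.
  by apply: lt0r_neq0; lra.
have EM : Ex Pr (fun om => M om ^+ 2) <= n%:R * (F / eps) ^+ 2.
  exact: martingale_square.
have EQ : Ex Pr (fun om => Q om ^+ 2) <=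
    15 / 16 * (F ^+ 2 * (\sum_(0 <= k < n) Num.sqrt (B k)) ^+ 2).
  (* The factor [eps] of the sampling error cancels the [1 / eps] in the bound on [g]. *)
  pose c k := Num.sqrt (15 / 16) * F * Num.sqrt (B k).
  have c0 k : 0 <= c k by rewrite !mulr_ge0 // sqrtr_ge0.
  have sqrt1516 : Num.sqrt (15 / 16) ^+ 2 = 15 / 16 :> R by rewrite sqr_sqrtr //; lra.
  apply: (@le_trans _ _ ((\sum_(1 <= k < n) c k) ^+ 2)).
    apply: Ex_sqr_sum_le => // k; rewrite mem_index_iota => /andP[k1 _].
    rewrite (_ : (fun om => _) =
        fun om => eps ^+ 2 * (theta k g om - integ pi g) ^+ 2); last first.
      by apply/funext => om; rewrite exprMn.
    rewrite [leLHS](integZ Pr1); last by apply/bmeasX/bmeasB.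
    have h := thetahat_square_error Pr pi piY Y mY w W y0 w0 wW bw piE k g _ k1 bg gF.
    apply: le_trans (ler_wpM2l (sqr_ge0 eps) h) _.
    rewrite /c !exprMn sqrt1516 sqr_sqrtr ?IR_B_ge0 //.
    have -> : B k = IR_Bn Pr piY W Y k by rewrite /IR_B eqn0Ngt k1.
    move: (IR_Bn _ _ _ _ _) => Bk.
    rewrite (_ : eps ^+ 2 * _ = 15 / 16 * F ^+ 2 * Bk) //.
    by field; exact: lt0r_neq0.
  apply: (@le_trans _ _ ((\sum_(0 <= k < n) c k) ^+ 2)).
    by rewrite lerXn2r ?nnegrE ?sumr_ge0 // [leRHS]big_ltn // lerDr.
  rewrite /c -mulr_sumr !exprMn sqrt1516.
  by rewrite -mulrA.
have bb : bmeas b.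
  apply: bmeasD; last exact: bQk.
  apply: bmeasD.
    by apply/bcM/bmeasB; exact: bmeas_comp.
  apply: (@bmeas_sum _ _ _ _ _ (fun i om => r (X i om) - integ pi r)) => i _.
  by apply: bmeasB => //; exact: bmeas_comp.
have bM2 := bmeasX _ 2 bM; have bQ2 := bmeasX _ 2 bQ.
have bM48 : bmeas (fun om => 48 * M om ^+ 2) by exact: bcM.
have bQ16 : bmeas (fun om => 16 / 15 * Q om ^+ 2) by exact: bcM.
pose K := 24 * (21 / 10 * (F / eps)) ^+ 2.
have bKM : bmeas (fun om => K + 48 * M om ^+ 2) by exact: bmeasD.
apply: (@le_trans _ _ (Ex Pr (fun om => K + 48 * M om ^+ 2 + 16 / 15 * Q om ^+ 2))).
  apply: (le_integ Pr1) => [| |om]; [|exact: bmeasD|].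
    apply/bmeasX/bmeas_sum => i _; exact: bmeasB.
  rewrite decomp; have : b om ^+ 2 <= (21 / 10 * (F / eps)) ^+ 2.
    by rewrite -[leLHS]real_normK ?num_real // lerXn2r ?nnegrE // (le_trans _ (bbd om)).
  rewrite /K; move: ((21 / 10 * (F / eps)) ^+ 2) (b om) (M om) (Q om) => k b' m q.
  (* The two squares give [(b + m) ^ 2 <= 3/2 b ^ 2 + 3 m ^ 2] and
     [(s + q) ^ 2 <= 16 s ^ 2 + 16/15 q ^ 2] with [s = b + m]; the factor 16/15 cancels the 15/16 of
     [EQ]. *)
  have := sqr_ge0 (b' - 2 * m); have := sqr_ge0 (15 * (b' + m) - q); nra.
rewrite [leLHS](integD Pr1) // (integD Pr1) // integ_cst // !(integZ Pr1) //.
rewrite -!/(Ex Pr _) /K exprMn.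
have := ler_wpM2r (sqr_ge0 (F / eps)) n1; have := sqr_ge0 (F / eps).
move: EM EQ; move: (Ex _ _) (Ex _ _) (F ^+ 2 * _) ((F / eps) ^+ 2) => a c q k.
by lra.
Qed.

End Process.

(** * The weight function and the sup norm *)

Section Weight.
Context {R : realType} {d : measure_display} {T : measurableType d}.
Implicit Types p q f : T -> R.

Lemma le_supnorm f x : bounded_fun f -> `|f x| <= supnorm f.
Proof.
by move=> /bounded_funP[M fM]; apply: ub_le_sup; [exists M => _ [y _ <-]|exists x].
Qed.

Lemma measurable_weight p q : measurable_fun [set: T] p ->
  measurable_fun [set: T] q -> (forall x, 0 <= q x) ->
  measurable_fun [set: T] (weight p q).
Proof.
move=> mp mq q0; rewrite (_ : weight p q = p \* (fun x => q x `^ (-1))).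
  by apply: measurable_funM => //; apply: (measurableT_comp (measurable_powR _)).
by apply/funext => x /=; rewrite powR_inv1.
Qed.

End Weight.

Theorem theorem1 (R : realType) (d : measure_display) (T : measurableType d)
  (mu : {measure set T -> \bar R}) (p pY : T -> R)
  (pi piY : probability T R) (eps : R) (P : R.-pker T ~> T)
  (dO : measure_display) (Om : measurableType dO) (Pr : probability Om R)
  (X Y : nat -> Om -> T) (Z : nat -> set Om) (x0 y0 : T) :
  (* the state space: Polish, Borel sigma-algebra, sigma-finite reference measure *)
  @polish_borel R d T ->
  sigma_finite [set: T] mu ->
  (* densities of pi and pi_Y *)
  measurable_fun [set: T] p -> measurable_fun [set: T] pY ->
  (forall x, 0 <= p x) -> (forall x, 0 <= pY x) ->
  (forall A, measurable A -> pi A = \int[mu]_(x in A) (p x)%:E)%E ->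
  (forall A, measurable A -> piY A = \int[mu]_(x in A) (pY x)%:E)%E ->
  (* w = pi / pi_Y is well defined with |w|_oo < oo *)
  (forall x, p x = weight p pY x * pY x) ->
  bounded_fun (weight p pY) ->
  (* epsilon in (0,1), P has stationary distribution pi *)
  0 < eps < 1 ->
  (forall A, measurable A -> (\int[pi]_x P x A = pi A)%E) ->
  (* the processes *)
  (forall n, measurable_fun [set: Om] (X n)) ->
  (forall n, measurable_fun [set: Om] (Y n)) ->
  (forall n, measurable (Z n)) ->
  (forall om, X 0%N om = x0) -> (forall om, Y 0%N om = y0) ->
  (* auxiliary process: E(h(Y_{n+1}) | F_n) = E(h(Y_{n+1}) | Y_0..Y_n) *)
  (forall n (h : T -> R), measurable_fun [set: T] h -> bounded_fun h ->
     exists V, cond_exp Pr (F_XY X Y n) (h \o Y n.+1) V /\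
               cond_exp Pr (F_Y Y n) (h \o Y n.+1) V) ->
  (* Z_n i.i.d. Bernoulli(eps), independent of {Y_k} and of F_{n-1} *)
  mutually_indep Pr Z ->
  (forall n, Pr (Z n.+1) = eps%:E) ->
  (forall n, indep_event Pr (Z n.+1) (F_allY_XY X Y n)) ->
  (* given F_{n-1}, X_n and Y_n are conditionally independent *)
  (forall n (f g : T -> R), measurable_fun [set: T] f -> bounded_fun f ->
     measurable_fun [set: T] g -> bounded_fun g ->
     forall V1 V2, cond_exp Pr (F_XY X Y n) (f \o X n.+1) V1 ->
                   cond_exp Pr (F_XY X Y n) (g \o Y n.+1) V2 ->
     cond_exp Pr (F_XY X Y n) (fun om => f (X n.+1 om) * g (Y n.+1 om))
                              (fun om => V1 om * V2 om)) ->
  (* given F_{n-1} and Z_n, X_n ~ theta_hat_{n-1} if Z_n = 1, P(X_{n-1}, .) if Z_n = 0 *)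
  (forall n (f : T -> R), measurable_fun [set: T] f -> bounded_fun f ->
     cond_exp Pr (F_XYZ X Y n (Z n.+1)) (f \o X n.+1)
       (fun om => if `[< Z n.+1 om >]
                  then thetahat (weight p pY) y0 Y n f om
                  else integ (P (X n om)) f)) ->
  let W := supnorm (weight p pY) in
  let B := IR_B Pr piY W Y in
  (forall n,
     tv_law Pr (X n) pi <=
       \sum_(0 <= l < n.+1) (1 - eps) ^+ (n - l) * IR_Bm1 Pr piY W Y l) /\
  (forall (f : T -> R), measurable_fun [set: T] f -> bounded_fun f ->
   forall n : nat, (0 < n)%N ->
     Ex Pr (fun om => ((Num.sqrt (n%:R))^-1 *
                       \sum_(1 <= i < n.+1) (f (X i om) - integ pi f)) ^+ 2)
     <= 80 * eps ^- 2 * (supnorm f) ^+ 2 / n%:R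
        + 64 * eps ^- 2 * (supnorm f) ^+ 2
        + (supnorm f) ^+ 2 *
          ((Num.sqrt (n%:R))^-1 * \sum_(0 <= k < n) Num.sqrt (B k)) ^+ 2).
Proof.
move=> _ _ mp mpY p0 pY0 piD piYD pE bw /[dup] eps01 /andP[e0 e1] stat mX mY mZ _ _ _ _.
move=> PrZ indepZ _ condX W B.
have mw := measurable_weight _ _ mp mpY pY0.
have bmw := bmeasP _ mw bw.
have w0 x : 0 <= weight p pY x by rewrite divr_ge0.
have wW x : weight p pY x <= W.
  by apply: le_trans (ler_norm _) _; exact: le_supnorm.
(* Both sides become the same integral against [mu], since [p] is the weight times [pY]. *)
have piE f : bmeas f -> integ pi f = integ piY (fun x => weight p pY x * f x).
  move=> bf; have bwf : bmeas (fun x => weight p pY x * f x) by exact: bmeasM.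
  rewrite (integ_density mu pi p _ (probability_setT pi) mp p0 piD bf).
  rewrite (integ_density mu piY pY _ (probability_setT piY) mpY pY0 piYD bwf).
  by congr integ; apply/funext => x; rewrite pE; ring.
split=> [n|f mf bf n n0].
  rewrite /tv_law ler_pdivrMl //; apply: ge_sup.
    (* Bounding a [sup] from above requires a nonempty set; the zero function provides a member. *)
    by exists `|Ex Pr ((fun=> 0) \o X n) - integ pi (fun=> 0)|; exists (fun=> 0) => //;
      split=> [|x]; [exact: measurable_cst|rewrite normr0].
  move=> _ [f uf <-].
  exact: (law_error Pr P X Y Z (weight p pY) y0 eps).
have bmf := bmeasP _ mf bf.
have fF x : `|f x| <= supnorm f by exact: le_supnorm.
have bS : bmeas (fun om => (\sum_(1 <= i < n.+1) (f (X i om) - integ pi f)) ^+ 2).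
  apply/bmeasX/bmeas_sum => i _; apply: bmeasB; first exact: bmeas_comp.
  exact: bmeas_cst.
have sqn : (Num.sqrt n%:R)^-1 ^+ 2 = n%:R^-1 :> R by rewrite exprVn sqr_sqrtr.
rewrite (_ : (fun om => _) = fun om =>
    n%:R^-1 * (\sum_(1 <= i < n.+1) (f (X i om) - integ pi f)) ^+ 2); last first.
  by apply/funext => om; rewrite exprMn sqn.
rewrite [leLHS](integZ (probability_setT Pr)) // exprMn sqn.
have := sum_square_error Pr P X Y Z (weight p pY) y0 eps mX mY mZ w0 bmw eps01
  PrZ indepZ condX pi piY W wW piE stat n f _ n0 bmf fF.
rewrite -/(Ex Pr _) -/B; set S := \sum_(0 <= k < n) _; move=> h.
have nR : 0 < n%:R :> R by rewrite ltr0n.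
rewrite ler_pdivrMl //; apply: le_trans h _; rewrite le_eqVlt; apply/orP; left.
by apply/eqP; field; rewrite !lt0r_neq0.
Qed.
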